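(* The curvature $R$ of the canonical connection $D$ of the tautological bundle $\mathcal{E}\to\mathcal{Q}_\rho$ and the $\mathcal{C}$-valued Hilbertian product in $\mathcal{Q}_\rho$ are related as follows: for all $q\in\mathcal{Q}_\rho$ and $X,Y\in(T\mathcal{Q}_\rho)_q$, $$\frac{i}{2}\,R(X,Y)_q=\operatorname{Im}\langle X,Y\rangle_q=\omega(X,Y)_q$$ as elements of $\mathcal{C}_q=\mathcal{L}_{\mathcal{A}}(R(q))$.
   Context: $\mathcal{A}$ is a unital C$^*$-algebra with unitary group $\mathcal{U}_{\mathcal{A}}$; $M_2(\mathcal{A})$ acts on the right $\mathcal{A}$-module $\mathcal{A}^2$ of column vectors $\mathbf{x}=(x_1,x_2)^t$, and $\mathbf{x}^*=(x_1^*,x_2^* )$. Let $\rho=\begin{pmatrix}1&0\\0&-1\end{pmatrix}$ and $\theta(\mathbf{x},\mathbf{y})=\mathbf{x}^*\rho\mathbf{y}=x_1^*y_1-x_2^*y_2$. For $\tilde a\in M_2(\mathcal{A})$ put $\tilde a^\sharp=\rho\tilde a^*\rho$. $\mathcal{Q}_\rho$ is the set of idempotents $q\in M_2(\mathcal{A})$ with $q^\sharp=q$ such that $\theta(\mathbf{x},\mathbf{x})\ge0$ for $\mathbf{x}$ in the range $R(q)$ and $\theta(\mathbf{x},\mathbf{x})\le 0$ for $\mathbf{x}$ in the nullspace $N(q)$. It is a complemented $C^\infty$ submanifold of $M_2(\mathcal{A})$ with $(T\mathcal{Q}_\rho)_q=\{X\in M_2(\mathcal{A}):\rho X^*\rho=X,\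 Xq+qX=X\}$. Let $\mathcal{K}=\{\mathbf{x}\in\mathcal{A}^2:\theta(\mathbf{x},\mathbf{x})=1,\ x_1\text{ invertible}\}$ and, for $\mathbf{x}\in\mathcal{K}$, $p_{\mathbf{x}}=\mathbf{x}\mathbf{x}^*\rho\in\mathcal{Q}_\rho$; every $q\in\mathcal{Q}_\rho$ is $p_{\mathbf{x}}$ for some $\mathbf{x}\in\mathcal{K}$, unique up to $\mathbf{x}\mapsto\mathbf{x}u$, $u\in\mathcal{U}_{\mathcal{A}}$, and $\{\mathbf{x}\}$ is a basis of the right $\mathcal{A}$-module $R(q)$. Coefficient bundle $\mathcal{C}$: its fiber over $q$ is the space $\mathcal{C}_q=\mathcal{L}_{\mathcal{A}}(R(q))$ of right $\mathcal{A}$-module endomorphisms of $R(q)$. For $\mathbf{x}\in\mathcal{K}$ with $p_{\mathbf{x}}=q$ and $a\in\mathcal{A}$, $[(\mathbf{x},a)]\in\mathcal{C}_q$ is the endomorphism $\mathbf{x}b\mapsto\mathbf{x}ab$; so $[(\mathbf{x},a)]=[(\mathbf{x}u,u^*au)]$ for $u\in\mathcal{U}_{\mathcal{A}}$. The map $a\mapsto[(\mathbf{x},a)]$ makes $\mathcal{C}_q$ a C$^*$-algebra isomorphic to $\mathcal{A}$, independently of $\mathbf{x}$. For $c$ in a C$^*$-algebra, $\operatorname{Im}c=\frac1{2i}(c-c^* )$. Hilbertian product: for $X,Y\in(T\mathcal{Q}_\rho)_q$, $\langle X,Y\rangle_q=[(\mathbf{x},-\theta(X\mathbf{x},Y\mathbf{x}))]\in\mathcal{C}_q$,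 where $p_{\mathbf{x}}=q$ (this does not depend on the choice of $\mathbf{x}$). Symplectic form: $\omega(X,Y)_q=\operatorname{Im}\langle X,Y\rangle_q$. Tautological bundle: $\mathcal{E}=\{(q,\mathbf{x}):q\in\mathcal{Q}_\rho,\ \mathbf{x}\in R(q)\}\to\mathcal{Q}_\rho$, $(q,\mathbf{x})\mapsto q$. Its canonical connection is $D_X\sigma=q(X\bullet\sigma)$, where $X\in(T\mathcal{Q}_\rho)_q$ and $X\bullet\sigma$ is the directional derivative of the section $\sigma$ regarded as an $\mathcal{A}^2$-valued function. Its curvature is $R(X,Y)\sigma=D_XD_Y\sigma-D_YD_X\sigma-D_{[X,Y]}\sigma$ (for local vector fields extending $X,Y$, with $[X,Y]$ the Lie bracket of fields), so $R(X,Y)_q$ is an endomorphism of $R(q)$. *)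

(* Defs.v *)
From HB Require Import structures.
From mathcomp Require Import all_boot all_order all_algebra.
From mathcomp Require Import complex.
From mathcomp Require Import all_classical all_reals all_analysis.

Set Implicit Arguments.
Unset Strict Implicit.
Unset Printing Implicit Defensive.

Import Order.TTheory GRing.Theory Num.Theory.
Import numFieldNormedType.Exports.

Local Open Scope classical_set_scope.
Local Open Scope ring_scope.
Local Open Scope complex_scope.

(* Unital C*-algebras over the complex numbers [R[i]]. The norm is a real-valued
   field of the structure: Hierarchy Builder admits no common substructure of
   noncommutative rings and of the normed modules of MathComp-Analysis. *)
HB.mixin Record isCStarAlgebra (R : realType) A of GRing.Algebra R[i] A := {
  star : A -> A ;
  cnorm : A -> R ;
  starK : involutive star ;
  starD : forall a b : A, star (a + b) = star a + star b ;
  starZ : forall (c : R[i]) (a : A), star (c *: a) = c^* *: star a ;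
  starM : forall a b : A, star (a * b) = star b * star a ;
  cnorm_eq0 : forall a : A, cnorm a = 0 -> a = 0 ;
  cnormD : forall a b : A, cnorm (a + b) <= cnorm a + cnorm b ;
  cnormZ : forall (c : R[i]) (a : A), cnorm (c *: a) = complex.Re `|c| * cnorm a ;
  cnormM : forall a b : A, cnorm (a * b) <= cnorm a * cnorm b ;
  cnorm_star : forall a : A, cnorm (star a * a) = cnorm a ^+ 2 ;
  cnorm_complete : forall u : nat -> A,
    (forall e : R, 0 < e -> exists N, forall m n, (N <= m)%N -> (N <= n)%N ->
       cnorm (u m - u n) < e) ->
    exists l, forall e : R, 0 < e -> exists N, forall n, (N <= n)%N ->
       cnorm (u n - l) < e
}.

#[short(type="cstarAlgType")]
HB.structure Definition CStarAlgebra (R : realType) :=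
  {A of isCStarAlgebra R A & GRing.Algebra R[i] A}.

Section CStarNorm.
Context {R : realType} {A : cstarAlgType R}.

Lemma cnorm0 : cnorm (0 : A) = 0.
Proof. by rewrite -(scale0r 0) cnormZ normr0 mul0r. Qed.

Lemma cnormN (a : A) : cnorm (- a) = cnorm a.
Proof. by rewrite -scaleN1r cnormZ normrN1 mul1r. Qed.

Lemma cnorm_ge0 (a : A) : 0 <= cnorm a.
Proof.
have := cnormD a (- a).
by rewrite subrr cnorm0 cnormN -mulr2n pmulrn_lge0.
Qed.

End CStarNorm.

Section Positivity.
Context {R : realType} {A : cstarAlgType R}.

Definition invertible (a : A) : Prop := exists b : A, a * b = 1 /\ b * a = 1.

Definition spectrum (a : A) : set R[i] := [set l | ~ invertible (a - l%:A)].

(* In [R[i]], [0 <= l] means that [l] is real and nonnegative. *)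
Definition positive (a : A) : Prop :=
  star a = a /\ spectrum a `<=` [set l | 0 <= l].

End Positivity.

(* Matrices over [A] as a real normed space. The norm is one of the equivalent
   norms inducing the topology of [M_2(A)] and of [A^2]; scalars are restricted
   to [R] since the manifold structure considered here is real. *)
Definition rmx (R : realType) (A : cstarAlgType R) (m n : nat) : Type :=
  'M[A]_(m, n).

Section RealMatrices.
Context {R : realType} {A : cstarAlgType R} {m n : nat}.
Local Notation V := (rmx A m n).

HB.instance Definition _ := GRing.Zmodule.copy V 'M[A]_(m, n).

Definition rmx_scale (r : R) (M : V) : V := \matrix_(i, j) (r%:C *: M i j).

Fact rmx_scaleA r s M : rmx_scale r (rmx_scale s M) = rmx_scale (r * s) M.
Proof. by apply/matrixP => i j; rewrite !mxE scalerA rmorphM. Qed.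

Fact rmx_scale1 : left_id 1 rmx_scale.
Proof. by move=> M; apply/matrixP => i j; rewrite !mxE rmorph1 scale1r. Qed.

Fact rmx_scaleDr : right_distributive rmx_scale +%R.
Proof. by move=> r M N; apply/matrixP => i j; rewrite !mxE scalerDr. Qed.

Fact rmx_scaleDl M : {morph rmx_scale^~ M : r s / r + s}.
Proof. by move=> r s; apply/matrixP => i j; rewrite !mxE rmorphD scalerDl. Qed.

HB.instance Definition _ := GRing.Zmodule_isLmodule.Build R V
  rmx_scaleA rmx_scale1 rmx_scaleDr rmx_scaleDl.

Definition rmx_norm (M : V) : R := \sum_i \sum_j cnorm (M i j).

Fact rmx_normD (M N : V) : rmx_norm (M + N) <= rmx_norm M + rmx_norm N.
Proof.
rewrite /rmx_norm -big_split /=; apply: ler_sum => i _.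
by rewrite -big_split /=; apply: ler_sum => j _; rewrite mxE cnormD.
Qed.

Fact rmx_normZ (r : R) (M : V) : rmx_norm (r *: M) = `|r| * rmx_norm M.
Proof.
rewrite /rmx_norm mulr_sumr; apply: eq_bigr => i _.
rewrite mulr_sumr; apply: eq_bigr => j _; rewrite mxE cnormZ; congr (_ * _).
by rewrite normc_def /= expr0n addr0 sqrtr_sqr.
Qed.

Fact rmx_norm_eq0 (M : V) : rmx_norm M = 0 -> M = 0.
Proof.
move=> /eqP; rewrite psumr_eq0; last by move=> i _; exact/sumr_ge0/(fun j _ => cnorm_ge0 _).
move=> /allP M0; apply/matrixP => i j; rewrite mxE; apply: cnorm_eq0.
have := M0 i (mem_index_enum _); rewrite /= psumr_eq0; last by move=> k _; exact: cnorm_ge0.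
by move=> /allP/(_ j (mem_index_enum _))/eqP.
Qed.

HB.instance Definition _ := Lmodule_isNormed.Build R V
  rmx_normD rmx_normZ rmx_norm_eq0.

End RealMatrices.

Section Smooth.
Context {R : realType}.

(* [f] is C^k on the open set [U] if it is continuous and, for [k > 0], Frechet
   differentiable on [U] with tangent map [(x, v) |-> 'd f x v] of class C^(k-1)
   on [U * V]. For a fixed [k] this is slightly weaker than requiring [k]
   operator-norm continuous derivatives; for all [k] at once it is equivalent. *)
Fixpoint Ck (k : nat) (V W : normedModType R) (U : set V) (f : V -> W) : Prop :=
  match k with
  | 0 => forall x, U x -> {for x, continuous f}
  | k'.+1 => (forall x, U x -> differentiable f x) /\
      @Ck k' (V * V)%type W (U `*` setT) (fun p => 'd f (p.1) (p.2))
  end.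

Definition smooth_on (V W : normedModType R) (U : set V) (f : V -> W) : Prop :=
  forall k, Ck k U f.

End Smooth.

Section Projections.
Context {R : realType} {A : cstarAlgType R}.
Implicit Types (q X Y : 'M[A]_2) (x y : 'cV[A]_2).

Definition adjoint (m n : nat) (M : 'M[A]_(m, n)) : 'M[A]_(n, m) :=
  (map_mx star M)^T.

Definition rho : 'M[A]_2 := \matrix_(i, j) ((-1) ^+ i *+ (i == j)).

Definition theta x y : A := (adjoint x *m rho *m y) 0 0.

Definition sharp (a : 'M[A]_2) : 'M[A]_2 := rho *m adjoint a *m rho.

Lemma thetaE x y :
  theta x y = star (x 0 0) * y 0 0 - star (x 1 0) * y 1 0.
Proof.
have r : forall i j, rho i j = (-1) ^+ i *+ (i == j) by move=> i j; rewrite mxE.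
rewrite /theta !mxE !big_ord_recl big_ord0 addr0 !mxE !big_ord_recl !big_ord0.
rewrite !r !mxE /= !(mulr0n, mulr1n, mulr0, mulr1, add0r, addr0, expr0, expr1).
by rewrite mulrN1 mulNr (_ : lift ord0 ord0 = 1) //; apply/val_inj.
Qed.

(* The right action of [A] on [A^2]. *)
Definition rscale x (b : A) : 'cV[A]_2 := \col_i (x i 0 * b).

Definition mrange q : set 'cV[A]_2 := [set x | exists w, x = q *m w].

Definition nullspace q : set 'cV[A]_2 := [set x | q *m x = 0].

Definition Qrho : set 'M[A]_2 := [set q | [/\ q *m q = q, sharp q = q,
  forall x, mrange q x -> positive (theta x x) &
  forall x, nullspace q x -> positive (- theta x x)]].

Definition tangent q : set 'M[A]_2 := [set X |
  rho *m adjoint X *m rho = X /\ X *m q + q *m X = X].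

Definition calK : set 'cV[A]_2 :=
  [set x | theta x x = 1 /\ invertible (x 0 0)].

Definition proj_of x : 'M[A]_2 := x *m adjoint x *m rho.

End Projections.

Section RangeModule.
Context {R : realType} {A : cstarAlgType R} (q : 'M[A]_2).

Definition in_mrange : {pred 'cV[A]_2} := fun x => `[< mrange q x >].

Fact in_mrange_zmod : zmod_closed in_mrange.
Proof.
split; first by apply/asboolP; exists 0; rewrite mulmx0.
move=> _ _ /asboolP[v ->] /asboolP[w ->]; apply/asboolP.
by exists (v - w); rewrite mulmxBr.
Qed.

HB.instance Definition _ := GRing.isZmodClosed.Build 'cV[A]_2 in_mrange
  in_mrange_zmod.

Record rangeMod := RangeMod { rval : 'cV[A]_2 ; _ : rval \in in_mrange }.

HB.instance Definition _ := [isSub for rval].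
HB.instance Definition _ := [Choice of rangeMod by <:].
HB.instance Definition _ := [SubChoice_isSubZmodule of rangeMod by <:].

Fact rscale_in_mrange (v : rangeMod) (b : A) : rscale (val v) b \in in_mrange.
Proof.
case: v => _ /= /asboolP[w ->]; apply/asboolP; exists (rscale w b).
apply/colP => i; rewrite !mxE mulr_suml; apply: eq_bigr => j _.
by rewrite mxE mulrA.
Qed.

Definition ract (v : rangeMod) (b : A) : rangeMod :=
  RangeMod (rscale_in_mrange v b).

(* Complex scalars are central, so they also act on [R(q)] from the left. *)
Fact cscale_in_mrange (c : R[i]) (v : rangeMod) : c%:A *: val v \in in_mrange.
Proof.
case: v => _ /= /asboolP[w ->]; apply/asboolP; exists (c%:A *: w).
apply/colP => i; rewrite !mxE mulr_sumr; apply: eq_bigr => j _.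
by rewrite mxE mulr_algl scalerAr mulr_algl.
Qed.

Definition cscale (c : R[i]) (v : rangeMod) : rangeMod :=
  RangeMod (cscale_in_mrange c v).

Fact cscaleA c d v : cscale c (cscale d v) = cscale (c * d) v.
Proof. by apply/val_inj => /=; rewrite scalerA mulr_algl scalerA. Qed.

Fact cscale1 : left_id 1 cscale.
Proof. by move=> v; apply/val_inj; rewrite /= !scale1r. Qed.

Fact cscaleDr : right_distributive cscale +%R.
Proof. by move=> c u v; apply/val_inj; rewrite /= scalerDr. Qed.

Fact cscaleDl v : {morph cscale^~ v : c d / c + d}.
Proof. by move=> c d; apply/val_inj; rewrite /= !scalerDl. Qed.

HB.instance Definition _ := GRing.Zmodule_isLmodule.Build R[i] rangeMod
  cscaleA cscale1 cscaleDr cscaleDl.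

Lemma ractDl u v b : ract (u + v) b = ract u b + ract v b.
Proof. by apply/val_inj/colP => i /=; rewrite !mxE mulrDl. Qed.

Lemma ractNl v b : ract (- v) b = - ract v b.
Proof. by apply/val_inj/colP => i /=; rewrite !mxE mulNr. Qed.

Lemma ract0 b : ract 0 b = 0.
Proof. by apply/val_inj/colP => i /=; rewrite !mxE mul0r. Qed.

Lemma ractZl (c : R[i]) v b : ract (c *: v) b = c *: ract v b.
Proof. by apply/val_inj/colP => i /=; rewrite !mxE mulrA. Qed.

Definition right_linear : {pred rangeMod -> rangeMod} := fun f =>
  `[< (forall u v, f (u + v) = f u + f v) /\
      (forall u b, f (ract u b) = ract (f u) b) >].

Fact right_linear_submod : submod_closed right_linear.
Proof.
split; first by apply/asboolP; split => [u v|u b]; rewrite ?ract0 ?addr0.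
move=> c f g /asboolP[fD fA] /asboolP[gD gA]; apply/asboolP.
split=> [u v|u b]; rewrite /= !fctE /=.
  by rewrite fD gD scalerDr addrACA.
by rewrite fA gA ractDl ractZl.
Qed.

HB.instance Definition _ := GRing.isSubmodClosed.Build R[i]
  (rangeMod -> rangeMod) right_linear right_linear_submod.

(* The fiber [C_q] of the coefficient bundle. *)
Record coefFiber := CoefFiber {
  coef_fun :> rangeMod -> rangeMod ;
  _ : coef_fun \in right_linear }.

HB.instance Definition _ := [isSub for coef_fun].
HB.instance Definition _ := [Choice of coefFiber by <:].
HB.instance Definition _ := [SubChoice_isSubLmodule of coefFiber by <:].

End RangeModule.

Section CoefficientBundle.
Context {R : realType} {A : cstarAlgType R}.
Implicit Types (q X Y : 'M[A]_2) (x : 'cV[A]_2) (a : A).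

(* The endomorphism [(x, a)] : x b |-> x a b of [R(q)], for [x] a basis of
   [R(q)]. *)
Definition coef_class q x a : coefFiber q :=
  xget 0 [set f : coefFiber q | forall (b : A) (v : rangeMod q),
    val v = rscale x b -> val (f v) = rscale x (a * b)].

(* Some [x] in [calK] with [p_x = q]. It is unique up to right multiplication by
   a unitary, and the constructions below do not depend on the choice. *)
Definition frame q : 'cV[A]_2 := xget 0 [set x | calK x /\ proj_of x = q].

(* The involution of [C_q], transported along [a |-> [(x, a)]]. *)
Definition coef_star q (c : coefFiber q) : coefFiber q :=
  coef_class q (frame q)
    (star (xget 0 [set a | coef_class q (frame q) a = c])).

Definition coef_Im q (c : coefFiber q) : coefFiber q :=
  (2 * 'i)^-1 *: (c - coef_star c).

Definition hilbert_product q X Y : coefFiber q :=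
  let x := frame q in coef_class q x (- theta (X *m x) (Y *m x)).

Definition omega q X Y : coefFiber q := coef_Im (hilbert_product q X Y).

End CoefficientBundle.

Section Curvature.
Context {R : realType} {A : cstarAlgType R}.
Local Notation M2 := (rmx A 2 2).
Local Notation A2 := (rmx A 2 1).

(* [Qrho] is a complemented submanifold of [M_2(A)], so smooth fields and
   sections over a neighbourhood of a point of [Qrho] are the restrictions to
   [Qrho] of smooth maps on open subsets [U] of [M_2(A)]. They are represented by
   such maps; only their values on [Qrho] are constrained. *)
Definition local_field (U : set M2) (X : M2 -> M2) : Prop :=
  smooth_on U X /\ forall r, U r -> Qrho r -> tangent r (X r).

Definition local_section (U : set M2) (s : M2 -> A2) : Prop :=
  smooth_on U s /\ forall r, U r -> Qrho r -> mrange r (s r).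

Definition connection (X : M2 -> M2) (s : M2 -> A2) : M2 -> A2 :=
  fun r => r *m ('d s r (X r) : A2).

Definition lie_bracket (X Y : M2 -> M2) : M2 -> M2 :=
  fun r => 'd Y r (X r) - 'd X r (Y r).

Definition is_curvature (q X Y : M2) (F : coefFiber q) : Prop :=
  forall (U : set M2) (Xf Yf : M2 -> M2) (s : M2 -> A2),
    open U -> U q -> local_field U Xf -> local_field U Yf ->
    local_section U s -> Xf q = X -> Yf q = Y ->
  forall v : rangeMod q, s q = val v ->
    val (F v) = connection Xf (connection Yf s) q
              - connection Yf (connection Xf s) q
              - connection (lie_bracket Xf Yf) s q.

(* [R(X, Y)_q]: for [q] in [Qrho] and [X], [Y] tangent at [q] there is exactly one
   endomorphism of [R(q)] satisfying [is_curvature]. *)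
Definition curvature (q X Y : M2) : coefFiber q :=
  xget 0 (@is_curvature q X Y).

End Curvature.

(* Main.v *)
Require Import Defs.
From HB Require Import structures.
From mathcomp Require Import all_boot all_order all_algebra.
From mathcomp Require Import complex.
From mathcomp Require Import all_classical all_reals all_analysis.
From mathcomp Require Import ring lra.

Set Implicit Arguments.
Unset Strict Implicit.
Unset Printing Implicit Defensive.

Import Order.TTheory GRing.Theory Num.Theory.
Import numFieldNormedType.Exports.
Local Open Scope classical_set_scope.
Local Open Scope ring_scope.
Local Open Scope complex_scope.

(** The proof compares both sides with the operator [X Y - Y X] on [R(q)].

    On the curvature side, fix smooth fields [Xf], [Yf] extending [X], [Y] and a
    smooth section [s]. Since the derivative of the identity map [r |-> r] in the
    direction [X] is [X], the product rule gives
    [D_X D_Y s = q (X ds(Y) + q (d(ds(Y))(X) + ds(dY(X))))]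
    (lemma [diff_connection]). After antisymmetrization the second derivatives of
    [s] cancel by Schwarz's theorem ([second_differential_sym]), the terms with
    [dY(X)] and [dX(Y)] cancel against the bracket, and what remains is
    [q X ds(Y) - q Y ds(X)]. A tangent vector satisfies [q X q = 0], so only
    [(1 - q) ds(Y)] matters. Differentiating [s(r) = r s(r)] gives
    [(1 - q) ds(Y) = Y s(q)] ([section_diff]); as this relation holds on [Qrho]
    only, it is differentiated along a curve in [Qrho] with velocity [Y], obtained
    from [q] by conjugation with the Cayley transforms of [t [Y, q] / 2], which
    preserve the form [theta] ([cayley_curve]). Hence the curvature is [X Y - Y X]
    on [R(q)] ([curvature_value]). That this value determines the curvature
    requires enough fields and sections; polynomial ones suffice
    ([curvature_fiber]).

    On the other side, for a frame [x] of [q], the equality [q = x x^* rho] and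
    [X^sharp = X] give [X Y x = x theta(X x, Y x)], so that
    [theta(X x, Y x)] is the coordinate of [X Y]. Its adjoint is
    [theta(Y x, X x)], and taking imaginary parts yields the commutator again.

    A frame of [q] exists because the corner [a = q 0 0] satisfies [1 <= a]: with
    [a = g g^*] and [g] invertible, [x = q e_0 h^*] with [h = g^-1] is one
    ([Qrho_frame]). Here
    positivity is a condition on the spectrum, and the factorization is obtained
    without functional calculus: along the segment from [1] to [a] all elements
    are invertible, and a factorization can be transported over short subintervals
    by square roots of elements close to [1] ([factor_above_one]). The passage
    from short subintervals to the whole segment is [interval_additive], which
    also gives the mean value inequality behind Schwarz's theorem. *)

(** * Norms of matrices over a C*-algebra *)

Section StarAlgebra.
Context {R : realType} {A : cstarAlgType R}.
Implicit Types a b : A.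

Lemma star0 : star (0 : A) = 0.
Proof. by apply: (addrI (star 0)); rewrite -starD !addr0. Qed.

Lemma starN a : star (- a) = - star a.
Proof. by apply/eqP; rewrite -addr_eq0 -starD addNr star0. Qed.

Lemma starB a b : star (a - b) = star a - star b.
Proof. by rewrite starD starN. Qed.

Lemma star1 : star (1 : A) = 1.
Proof. by rewrite -[LHS]mul1r -{1}[1]starK -starM mul1r starK. Qed.

Lemma star_sum (I : Type) (r : seq I) (P : pred I) (F : I -> A) :
  star (\sum_(i <- r | P i) F i) = \sum_(i <- r | P i) star (F i).
Proof. by apply: (big_morph star starD star0). Qed.

(** The C*-identity and submultiplicativity give [|c|^2 <= |c^*| |c|]. *)
Lemma cnorm_starE a : cnorm (star a) = cnorm a.
Proof.
suff le_star (c : A) : cnorm c <= cnorm (star c).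
  by apply/eqP; rewrite eq_le le_star -{2}[a]starK le_star.
have [->|c0] := eqVneq (cnorm c) 0; first exact: cnorm_ge0.
have cp : 0 < cnorm c by rewrite lt_def c0 cnorm_ge0.
by rewrite -(ler_pM2r cp) -expr2 -cnorm_star cnormM.
Qed.

End StarAlgebra.

Section MatrixNorm.
Context {R : realType} {A : cstarAlgType R}.

Lemma rmx_normE m n (M : rmx A m n) : `|M| = \sum_i \sum_j cnorm (M i j).
Proof. by []. Qed.

Lemma cnorm_entry m n (M : rmx A m n) i j : cnorm (M i j) <= `|M|.
Proof.
rewrite rmx_normE (bigD1 i) //= (bigD1 j) //= -addrA lerDl.
by apply: addr_ge0; do ?[apply: sumr_ge0 => ? _]; exact: cnorm_ge0.
Qed.

Lemma norm_mulmx m n p (M : rmx A m n) (N : rmx A n p) :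
  `|(M *m N : rmx A m p)| <= `|M| * `|N|.
Proof.
rewrite !rmx_normE mulr_suml; apply: ler_sum => i _.
have le1 j : cnorm ((M *m N) i j) <= \sum_k cnorm (M i k) * cnorm (N k j).
  rewrite mxE; elim/big_ind2: _ => [|x1 x2 y1 y2 h1 h2|k _].
  - by rewrite cnorm0.
  - by apply: le_trans (cnormD _ _) _; exact: lerD.
  - exact: cnormM.
apply: le_trans (ler_sum _ (fun j _ => le1 j)) _.
rewrite exchange_big mulr_suml; apply: ler_sum => k _.
rewrite -mulr_sumr ler_wpM2l ?cnorm_ge0 // (bigD1 k) //= lerDl.
by apply: sumr_ge0 => ? _; apply: sumr_ge0 => ? _; exact: cnorm_ge0.
Qed.

Lemma norm_adjoint m n (M : rmx A m n) : `|(adjoint M : rmx A n m)| = `|M|.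
Proof.
rewrite !rmx_normE exchange_big; apply: eq_bigr => i _; apply: eq_bigr => j _.
by rewrite !mxE cnorm_starE.
Qed.

(** Completeness of matrices is inherited entrywise from that of the algebra;
    geometric decay of the increments makes every entry a Cauchy sequence. *)
Lemma rmx_geometric_cvg m n (u : nat -> rmx A m n) (C : R) :
  (forall k, `|u k.+1 - u k| <= C / 2 ^+ k) ->
  exists l : rmx A m n, forall e : R, 0 < e ->
    exists N, forall k, (N <= k)%N -> `|u k - l| < e.
Proof.
move=> uC.
have C0 : 0 <= C by have := uC 0%N; rewrite expr0 divr1; exact: le_trans.
have tail k j : `|u (k + j)%N - u k| <= C * 2 / 2 ^+ k - C * 2 / 2 ^+ (k + j).
  elim: j => [|j IH]; first by rewrite addn0 !subrr normr0.
  rewrite addnS -(subrKA (u (k + j)%N)).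
  apply: le_trans (ler_normD _ _) _.
  apply: le_trans (lerD (uC _) IH) _.
  rewrite exprS invfM; set x := _^-1; set y := _^-1; lra.
have small e : 0 < e -> exists N, C * 2 / 2 ^+ N < e.
  move=> e0; pose K := Num.truncn (C * 2 / e); exists K.+1.
  have Ke : C * 2 / e < K.+1%:R by exact: truncnS_gt.
  rewrite ltr_pdivrMr ?exprn_gt0 // -ltr_pdivrMl // mulrC.
  apply: lt_trans Ke _.
  by rewrite -natrX ltr_nat; exact: ltn_expl.
have cau e : 0 < e -> exists N, forall a b, (N <= a)%N -> (N <= b)%N ->
    `|u a - u b| < e.
  move=> e0; have [N HN] := small (e / 2) ltac:(lra); exists N.
  have near k : (N <= k)%N -> `|u k - u N| < e / 2.
    move=> Nk; rewrite -(subnKC Nk); apply: le_lt_trans (tail _ _) _.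
    apply: le_lt_trans HN; rewrite gerBl divr_ge0 ?exprn_ge0 //; lra.
  move=> a b /near ha /near hb; rewrite -(subrKA (u N)).
  apply: le_lt_trans (ler_normD _ _) _; rewrite [X in _ + X]distrC; lra.
have /choice[l0 Hl0] : forall ij : 'I_m * 'I_n, exists l : A, forall e : R, 0 < e ->
    exists N, forall k, (N <= k)%N -> cnorm (u k ij.1 ij.2 - l) < e.
  move=> [i j]; apply: (cnorm_complete (fun k => u k i j)) => e /cau[N HN].
  exists N => a b ha hb; apply: le_lt_trans (HN a b ha hb) => /=.
  have -> : u a i j - u b i j = (u a - u b) i j by rewrite !mxE.
  exact: cnorm_entry.
exists (\matrix_(i, j) l0 (i, j)) => e e0.
pose D : R := (m * n).+1%:R.
have D0 : 0 < D by rewrite ltr0n.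
have eD : 0 < e / D by rewrite divr_gt0.
have /choice[N HN] : forall ij, exists N, forall k, (N <= k)%N ->
    cnorm (u k ij.1 ij.2 - l0 ij) < e / D.
  by move=> ij; exact: Hl0.
exists (\max_ij N ij) => k hk.
have hij i j : cnorm ((u k - \matrix_(i, j) l0 (i, j)) i j) <= e / D.
  rewrite !mxE; apply/ltW/(HN (i, j)).
  by apply: leq_trans hk; exact: (leq_bigmax (i, j)).
rewrite rmx_normE; apply: (@le_lt_trans _ _ (\sum_(i < m) \sum_(j < n) e / D)).
  by apply: ler_sum => i _; apply: ler_sum => j _; exact: hij.
under eq_bigr do rewrite sumr_const card_ord.
rewrite sumr_const card_ord -mulrnA mulnC -mulr_natr mulrAC ltr_pdivrMr //.
by rewrite ltr_pM2l // ltr_nat.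
Qed.

Lemma rmx_eq_lim m n (x : rmx A m n) :
  (forall e : R, 0 < e -> `|x| <= e) -> x = 0.
Proof.
move=> h; apply/eqP; rewrite -normr_le0; apply/ler_addgt0Pr => e e0.
by rewrite add0r h.
Qed.

(** Banach's fixed point theorem on a closed ball, with contraction constant
    [1/2]; it yields both inverses and square roots near the identity. *)
Lemma rmx_fixpoint m n (T : rmx A m n -> rmx A m n) (r : R) : 0 <= r ->
  (forall y, `|y| <= r -> `|T y| <= r) ->
  (forall y z, `|y| <= r -> `|z| <= r -> `|T y - T z| <= `|y - z| / 2) ->
  exists y, `|y| <= r /\ T y = y.
Proof.
move=> r0 Tr Tc; pose u k := iter k T 0.
have ur k : `|u k| <= r by elim: k => [|k IH]; rewrite /= ?normr0 ?Tr.
have [l Hl] : exists l : rmx A m n, forall e : R, 0 < e ->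
    exists N, forall k, (N <= k)%N -> `|u k - l| < e.
  apply: (@rmx_geometric_cvg _ _ u r) => k; elim: k => [|k IH].
    by rewrite expr0 divr1 subr0; exact: (ur 1%N).
  apply: le_trans (Tc (u k.+1) (u k) (ur _) (ur _)) _.
  by rewrite exprSr invfM mulrA ler_pM2r.
have lr : `|l| <= r.
  apply/ler_addgt0Pr => e /Hl[N /(_ N (leqnn _))/ltW HN].
  rewrite -[l](subrK (u N)) addrC; apply: le_trans (ler_normD _ _) _.
  by rewrite lerD // distrC.
exists l; split=> //; apply/eqP; rewrite -subr_eq0; apply/eqP.
apply: rmx_eq_lim => e e0; have [N HN] := Hl (e / 2) ltac:(lra).
rewrite -(subrKA (u N.+1)); apply: le_trans (ler_normD _ _) _.
have h1 : `|T l - u N.+1| <= `|u N - l| / 2.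
  by rewrite (distrC (u N)); exact: (Tc l (u N)).
have h2 := HN N (leqnn _); have h3 := HN N.+1 (leqnSn _).
lra.
Qed.

Lemma rmx11_normE (M : rmx A 1 1) : `|M| = cnorm (M 0 0).
Proof. by rewrite rmx_normE !big_ord1. Qed.

End MatrixNorm.

(** * Inverses and square roots near the identity *)

Section Adjoint.
Context {R : realType} {A : cstarAlgType R}.

Lemma adjointK m n (M : 'M[A]_(m, n)) : adjoint (adjoint M) = M.
Proof. by apply/matrixP => i j; rewrite !mxE starK. Qed.

Lemma adjointD m n (M N : 'M[A]_(m, n)) :
  adjoint (M + N) = adjoint M + adjoint N.
Proof. by apply/matrixP => i j; rewrite !mxE starD. Qed.

Lemma adjointN m n (M : 'M[A]_(m, n)) : adjoint (- M) = - adjoint M.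
Proof. by apply/matrixP => i j; rewrite !mxE starN. Qed.

Lemma adjointB m n (M N : 'M[A]_(m, n)) :
  adjoint (M - N) = adjoint M - adjoint N.
Proof. by rewrite adjointD adjointN. Qed.

Lemma adjointM m n p (M : 'M[A]_(m, n)) (N : 'M[A]_(n, p)) :
  adjoint (M *m N) = adjoint N *m adjoint M.
Proof.
apply/matrixP => i j; rewrite !mxE star_sum; apply: eq_bigr => k _.
by rewrite !mxE starM.
Qed.

Lemma adjoint1 n : adjoint (1%:M : 'M[A]_n) = 1%:M.
Proof.
apply/matrixP => i j; rewrite !mxE eq_sym.
by case: (_ == _); rewrite ?star1 ?star0.
Qed.

Lemma starZr (r : R) (a : A) : star (r%:C *: a) = r%:C *: star a.
Proof. by rewrite starZ (_ : Num.conj r%:C = r%:C) //; exact: conjc_real. Qed.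

Lemma adjointZ m n (r : R) (M : rmx A m n) :
  adjoint (r *: M) = r *: (adjoint M : rmx A n m).
Proof. by apply/matrixP => i j; rewrite !mxE starZr. Qed.

Lemma rscalemxAl m n p (r : R) (M : rmx A m n) (N : rmx A n p) :
  (r *: M : rmx A m n) *m N = r *: (M *m N : rmx A m p).
Proof.
apply/matrixP => i j; rewrite !mxE scaler_sumr; apply: eq_bigr => k _.
by rewrite mxE scalerAl.
Qed.

Lemma rscalemxAr m n p (r : R) (M : rmx A m n) (N : rmx A n p) :
  M *m (r *: N : rmx A n p) = r *: (M *m N : rmx A m p).
Proof.
apply/matrixP => i j; rewrite !mxE scaler_sumr; apply: eq_bigr => k _.
by rewrite mxE scalerAr.
Qed.

Lemma cnorm1_le1 : cnorm (1 : A) <= 1.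
Proof.
have := cnorm_star (1 : A); rewrite star1 mul1r => h.
have := cnorm_ge0 (1 : A); nra.
Qed.

Lemma cnormZr (r : R) (a : A) : cnorm (r%:C *: a) = `|r| * cnorm a.
Proof. by rewrite cnormZ normc_def /= expr0n addr0 sqrtr_sqr. Qed.

End Adjoint.

Section NearIdentity.
Context {R : realType} {A : cstarAlgType R}.

(** The inverse [B] is the fixed point of [y |-> 1 + E y]; the fixed point of
    [y |-> 1 + y E] is a left inverse, hence equal to it. *)
Lemma neumann n (E : rmx A n n) : `|E| <= 1 / 2 ->
  exists B : rmx A n n, [/\ (1%:M - E) *m B = 1%:M, B *m (1%:M - E) = 1%:M
    & `|B| <= 2 * `|1%:M : rmx A n n|].
Proof.
move=> E2; set I := 1%:M : rmx A n n.
have I0 : 0 <= `|I| by [].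
have small (y : rmx A n n) : `|E *m y : rmx A n n| <= `|y| / 2.
  by have := norm_mulmx E y; have := normr_ge0 y; nra.
have small' (y : rmx A n n) : `|y *m E : rmx A n n| <= `|y| / 2.
  by have := norm_mulmx y E; have := normr_ge0 y; nra.
have [B [BI EB]] : exists y : rmx A n n, `|y| <= 2 * `|I| /\
    I + (E *m y : rmx A n n) = y.
  apply: rmx_fixpoint => [|y hy|y z _ _]; first by rewrite mulr_ge0.
    by apply: le_trans (ler_normD _ _) _; have := small y; lra.
  by rewrite opprD addrACA subrr add0r -mulmxBr.
have [B' [_ EB']] : exists y : rmx A n n, `|y| <= 2 * `|I| /\
    I + (y *m E : rmx A n n) = y.
  apply: rmx_fixpoint => [|y hy|y z _ _]; first by rewrite mulr_ge0.
    by apply: le_trans (ler_normD _ _) _; have := small' y; lra.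
  by rewrite opprD addrACA subrr add0r -mulmxBl.
have rB : (1%:M - E) *m B = 1%:M.
  by rewrite mulmxBl mul1mx -{1}EB addrK.
have lB : B' *m (1%:M - E) = 1%:M.
  by rewrite mulmxBr mulmx1 -{1}EB' addrK.
exists B; split=> //; suff <- : B' = B by [].
by rewrite -[B']mulmx1 -rB mulmxA lB mul1mx.
Qed.

(** With [y = (y^2 - W) / 2] one has [(1 - y)^2 = 1 + W]. The fixed point is
    self-adjoint because its adjoint is a fixed point in the same ball. *)
Lemma sqrt_near1 n (W : rmx A n n) : adjoint W = W -> `|W| <= 1 / 4 ->
  exists y : rmx A n n, [/\ adjoint y = y, `|y| <= 1 / 4 &
    (1%:M - y) *m (1%:M - y) = 1%:M + W].
Proof.
move=> Wsa W4.
pose T (y : rmx A n n) : rmx A n n := 2^-1 *: ((y *m y : rmx A n n) - W).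
have Tn (y : rmx A n n) : `|y| <= 1 / 4 -> `|T y| <= 1 / 4.
  move=> hy; rewrite normrZ gtr0_norm ?invr_gt0 //.
  have h1 := ler_normB (y *m y : rmx A n n) W.
  by have h2 := norm_mulmx y y; have := normr_ge0 y; nra.
have Tc (y z : rmx A n n) : `|y| <= 1 / 4 -> `|z| <= 1 / 4 ->
    `|T y - T z| <= `|y - z| / 2.
  move=> hy hz; rewrite -scalerBr normrZ gtr0_norm ?invr_gt0 // opprB addrA subrK.
  have -> : (y *m y : rmx A n n) - (z *m z) =
      (y *m (y - z) : rmx A n n) + ((y - z) *m z : rmx A n n).
    by rewrite mulmxBr mulmxBl addrA subrK.
  have h1 := ler_normD (y *m (y - z) : rmx A n n) ((y - z) *m z : rmx A n n).
  have h2 := norm_mulmx y (y - z); have h3 := norm_mulmx (y - z) z.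
  have h4 := normr_ge0 (y - z); nra.
have T4 : 0 <= 1 / 4 :> R by lra.
have [y [hy Ty]] := rmx_fixpoint T4 Tn Tc.
have ysa : adjoint y = y.
  have Tys : T (adjoint y) = adjoint y.
    by rewrite -{2}Ty adjointZ adjointB adjointM Wsa.
  have := Tc y (adjoint y : rmx A n n) hy; rewrite norm_adjoint => /(_ hy).
  rewrite Tys Ty => h.
  have : `|y - (adjoint y : rmx A n n)| <= 0.
    by have := normr_ge0 (y - (adjoint y : rmx A n n)); lra.
  by rewrite normr_le0 subr_eq0 => /eqP.
exists y; split=> //.
have y2 : (y *m y : rmx A n n) - W = y + y.
  have -> : y + y = 2 *: y by rewrite scaler_nat mulr2n.
  by rewrite -{3}Ty scalerA mulfV ?scale1r // pnatr_eq0.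
have -> : W = (y *m y : rmx A n n) - (y + y) by rewrite -y2 opprB addrC subrK.
rewrite mulmxBl mul1mx mulmxBr mulmx1.
by rewrite opprB opprD -addrA (addrCA (- y)).
Qed.

Lemma neumannA (e : A) : cnorm e <= 1 / 2 ->
  exists b, [/\ (1 - e) * b = 1, b * (1 - e) = 1 & cnorm b <= 2].
Proof.
move=> he; have hE : `|(const_mx e : rmx A 1 1)| <= 1 / 2.
  by rewrite rmx11_normE mxE.
have [B [/matrixP/(_ 0 0) h1 /matrixP/(_ 0 0) h2 h3]] := neumann hE.
exists (B 0 0); split.
- by move: h1; rewrite !mxE big_ord1 !mxE eqxx.
- by move: h2; rewrite !mxE big_ord1 !mxE eqxx.
- move: h3; rewrite !rmx11_normE !mxE eqxx mulr1n => h3.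
  by have := cnorm1_le1 (A := A); lra.
Qed.

Lemma sqrt_near1A (w : A) : star w = w -> cnorm w <= 1 / 4 ->
  exists k, [/\ star k = k, k * k = 1 + w & invertible k].
Proof.
move=> ws hw; have hW : `|(const_mx w : rmx A 1 1)| <= 1 / 4.
  by rewrite rmx11_normE mxE.
have Ws : adjoint (const_mx w : rmx A 1 1) = const_mx w.
  by apply/matrixP => i j; rewrite !mxE.
have [y [/matrixP/(_ 0 0) ys yn /matrixP/(_ 0 0) y2]] := sqrt_near1 Ws hW.
move: ys yn y2; rewrite rmx11_normE !mxE big_ord1 !mxE eqxx => ys yn y2.
exists (1 - y 0 0); split=> //; first by rewrite starB star1 ys.
have [b [? ? _]] : exists b, [/\ (1 - y 0 0) * b = 1, b * (1 - y 0 0) = 1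
  & cnorm b <= 2] by apply: neumannA; lra.
by exists b.
Qed.

End NearIdentity.

(** * Factorization of elements above the identity *)

(** Cousin's principle: a relation between endpoints which is additive on
    intervals and holds on every small interval around each point [c] holds on the
    whole unit interval. The supremum of the points reached from [0] is [1]. *)
Lemma interval_additive (R : realType) (Q : R -> R -> Prop) :
  (forall a b c, a <= b <= c -> Q a b -> Q b c -> Q a c) ->
  (forall c, 0 <= c <= 1 -> exists2 d, 0 < d & forall a b, 0 <= a -> b <= 1 ->
     c - d < a <= c -> c <= b < c + d -> Q a b) ->
  Q 0 1.
Proof.
move=> Qtrans Qloc; pose S : set R := [set t | 0 <= t <= 1 /\ Q 0 t].
have [d0 d0p Q0] := Qloc 0 ltac:(lra).
have S0 : S 0 by split; [lra|apply: Q0; lra].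
have ubS : ubound S 1 by move=> t [/andP[_]].
have supS : has_sup S by split; [exists 0|exists 1].
have [c cE] : exists c, c = sup S by exists (sup S).
have c0 : 0 <= c by rewrite cE; apply: ub_le_sup => //; exists 1.
have c1 : c <= 1 by rewrite cE; apply: ge_sup => //; exists 0.
have [d dp Qc] := Qloc c ltac:(lra).
have [t [/andP[t0 t1] Qt]] := sup_adherent dp supS; rewrite -cE => ct.
have tc : t <= c by rewrite cE; apply: ub_le_sup; [exists 1|split=> //; lra].
have Sb b : c <= b -> b <= 1 -> b < c + d -> S b.
  move=> cb b1 bd; split; first lra.
  by apply: (Qtrans _ t); [lra|exact: Qt|apply: Qc => //; lra].
have [c1'|c1'] := leP 1 (c + d / 2).
  have [] // : S 1 by apply: Sb; lra.
have : S (c + d / 2) by apply: Sb; lra.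
by move=> /(ub_le_sup (ex_intro _ 1 ubS)); rewrite -cE; lra.
Qed.

Section Factorization.
Context {R : realType} {A : cstarAlgType R}.
Implicit Types a b g : A.

(** Write [a_s = 1 + s (a - 1)]. If [a_u = g g^*] with [g] invertible and
    [h = g^-1], then [a_v = g (1 + w) g^*] with [w = (v - u) h (a - 1) h^*]. Once
    [v - u] is small, [1 + w] has a self-adjoint square root [k], and
    [a_v = (g k) (g k)^*]. The admissible step depends only on [|h|^2 = |a_u^-1|],
    which is bounded locally in [u]. *)
Lemma factor_of_invertible_segment a : star a = a ->
  (forall s : R, 0 <= s <= 1 -> invertible (1 + s%:C *: (a - 1))) ->
  exists g, a = g * star g /\ invertible g.
Proof.
move=> asa; set e := a - 1 => ainv.
have esa : star e = e by rewrite starB asa star1.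
have ea : 1 + e = a by rewrite addrC subrK.
move: e esa ea ainv => e esa ea ainv.
pose P (s : R) := exists g, 1 + s%:C *: e = g * star g /\ invertible g.
suff : P 0 -> P 1.
  case; last by move=> g; rewrite scale1r ea; exists g.
  exists 1; rewrite scale0r addr0 star1 mulr1; split=> //.
  by exists 1; rewrite mulr1.
apply: (interval_additive (Q := fun u v => P u -> P v)).
  by move=> u v w _ h1 h2 /h1/h2.
move=> c c01.
have [b [ab ba]] := ainv c c01.
set N := cnorm b; set D := cnorm e.
have N0 : 0 <= N by exact: cnorm_ge0.
have D0 : 0 <= D by exact: cnorm_ge0.
have ND0 : 0 <= N * D by exact: mulr_ge0.
(* [d N D <= 1/16]: this makes both perturbations below small enough *)
pose d := (16 * (N * D) + 1)^-1.
have dp : 0 < d by rewrite invr_gt0; lra.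
have dE : d * (16 * (N * D) + 1) = 1 by rewrite mulVf // gt_eqF //; lra.
have dND : d * (N * D) <= 1 / 16 by lra.
exists d => // u v u0 v1 huc hvc [g [ug [h [gh hg]]]].
(* [B b] is the inverse of the value at [u], of norm at most [2 N] *)
have [B [_ B1 B2]] : exists B, [/\ (1 - (c - u)%:C *: (b * e)) * B = 1,
    B * (1 - (c - u)%:C *: (b * e)) = 1 & cnorm B <= 2].
  apply: neumannA; rewrite cnormZr ger0_norm; last lra.
  by have := cnormM b e; have := cnorm_ge0 (b * e); rewrite -/N -/D; nra.
have Bb : B * b * (1 + u%:C *: e) = 1.
  have bE : b + c%:C *: (b * e) = 1 by rewrite -ba mulrDr mulr1 -scalerAr.
  rewrite -[RHS]B1 -mulrA; congr (_ * _).
  rewrite mulrDr mulr1 -scalerAr -bE -addrA; congr (_ + _).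
  by rewrite -scalerBl -rmorphB opprB addrC subrK.
(* by the C*-identity, a bound on the inverse of [g g^*] bounds [h] *)
have hh : star h * h = B * b.
  have hgs : star h * star g = 1 by rewrite -starM gh star1.
  have gsh : star g * star h = 1 by rewrite -starM hg star1.
  have <- : B * b * (1 + u%:C *: e) * (star h * h) = B * b.
    by rewrite ug -!mulrA (mulrA (star g)) gsh mul1r gh mulr1.
  by rewrite Bb mul1r.
have hn : cnorm h ^+ 2 <= 2 * N.
  rewrite -cnorm_star hh; apply: le_trans (cnormM _ _) _.
  by rewrite ler_wpM2r.
have [k [ks kk [l [kl lk]]]] : exists k, [/\ star k = k,
    k * k = 1 + (v - u)%:C *: (h * e * star h) & invertible k].
  apply: sqrt_near1A.
    by rewrite starZr !starM starK esa mulrA.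
  rewrite cnormZr ger0_norm; last lra.
  have n1 := cnormM (h * e) (star h); rewrite cnorm_starE in n1.
  have n2 := cnormM h e; have n3 := cnorm_ge0 h.
  have n4 : cnorm (h * e * star h) <= cnorm h ^+ 2 * D.
    apply: le_trans n1 _; rewrite expr2 mulrAC; exact: ler_wpM2r.
  have n5 : cnorm h ^+ 2 * D <= 2 * N * D by exact: ler_wpM2r.
  have n6 : v - u <= 2 * d by lra.
  have n7 := cnorm_ge0 (h * e * star h).
  apply: (@le_trans _ _ (2 * d * (2 * N * D))); last lra.
  by apply: ler_pM => //; lra.
exists (g * k); split; last first.
  exists (l * h); split.
    by rewrite mulrA -(mulrA g) kl mulr1.
  by rewrite mulrA -(mulrA l) hg mulr1.
rewrite starM ks mulrA -(mulrA g) kk mulrDr mulr1 mulrDl -ug.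
rewrite -scalerAr -scalerAl !mulrA gh mul1r -mulrA -starM gh star1 mulr1.
by rewrite -addrA -scalerDl -rmorphD (addrC u) subrK.
Qed.

(** For [s > 0], invertibility says that [- s^-1] is not in the spectrum of
    [a - 1]. *)
Lemma positive_shift_invertible a (s : R) : positive (a - 1) -> 0 <= s ->
  invertible (1 + s%:C *: (a - 1)).
Proof.
move=> [_ spec] s0; have [->|sn0] := eqVneq s 0.
  by exists 1; rewrite scale0r addr0 mulr1.
have sp : 0 < s by rewrite lt_def sn0.
have : ~ spectrum (a - 1) (- s^-1)%:C.
  by move=> /spec /=; rewrite lecR lerNr oppr0 invr_le0; lra.
move=> /contrapT[b [h1 h2]].
have E : 1 + s%:C *: (a - 1) = s%:C *: (a - 1 - (- s^-1)%:C%:A).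
  rewrite [RHS]scalerBr scalerA -rmorphM mulrN mulfV // rmorphN1 scaleN1r.
  by rewrite opprK addrC.
exists (s^-1%:C *: b); rewrite E -!scalerAl -!scalerAr h1 h2 !scalerA -!rmorphM.
by rewrite mulfV // mulVf // scale1r.
Qed.

Lemma factor_above_one a : positive (a - 1) ->
  exists g, a = g * star g /\ invertible g.
Proof.
move=> pa; apply: factor_of_invertible_segment => [|s /andP[s0 _]].
  by case: pa => /eqP; rewrite starB star1 (inj_eq (addIr _)) => /eqP.
exact: positive_shift_invertible.
Qed.

(** Otherwise [-1] would be in the spectrum of [- a], as [a (1 - a) = 0]. *)
Lemma idempotent_positive_opp a : a * a = a -> positive (- a) -> a = 0.
Proof.
move=> aa [_ spec].
have : ~ spectrum (- a) (-1)%:C.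
  by move=> /spec /=; rewrite lecR; lra.
move=> /contrapT[b [_ h2]].
rewrite rmorphN1 scaleN1r opprK in h2.
by rewrite -[a]mul1r -h2 -mulrA mulrDl mulNr aa mul1r addNr mulr0.
Qed.

End Factorization.

(** * The indefinite form and frames *)

Section IndefiniteForm.
Context {R : realType} {A : cstarAlgType R}.
Implicit Types (q a X Y : 'M[A]_2) (x y : 'cV[A]_2).
Local Notation rho := (@rho R A).

Lemma mul_rho_mx n (M : 'M[A]_(2, n)) i j : (rho *m M) i j = (-1) ^+ i * M i j.
Proof.
rewrite mxE (bigD1 i) //= mxE eqxx mulr1n big1 ?addr0 // => k ki.
by rewrite mxE eq_sym (negbTE ki) mulr0n mul0r.
Qed.

Lemma mul_mx_rho n (M : 'M[A]_(n, 2)) i j : (M *m rho) i j = M i j * (-1) ^+ j.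
Proof.
rewrite mxE (bigD1 j) //= mxE eqxx mulr1n big1 ?addr0 // => k kj.
by rewrite mxE (negbTE kj) mulr0n mulr0.
Qed.

Lemma rhoK : rho *m rho = 1%:M.
Proof.
apply/matrixP => i j.
by rewrite mul_rho_mx !mxE mulrnAr -expr2 sqrr_sign.
Qed.

Lemma adjoint_rho : adjoint rho = rho.
Proof.
apply/matrixP => i j; rewrite !mxE eq_sym; case: eqVneq => [->|_].
  by rewrite !mulr1n -signr_odd; case: (odd _); rewrite ?starN star1.
by rewrite !mulr0n star0.
Qed.

Lemma sharpE a i j : sharp a i j = (-1) ^+ i * star (a j i) * (-1) ^+ j.
Proof. by rewrite /sharp mul_mx_rho mul_rho_mx !mxE. Qed.

Lemma sharpK a : sharp (sharp a) = a.
Proof.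
rewrite /sharp !adjointM adjoint_rho adjointK !mulmxA rhoK mul1mx.
by rewrite -mulmxA rhoK mulmx1.
Qed.

Lemma sharpD a X : sharp (a + X) = sharp a + sharp X.
Proof. by rewrite /sharp adjointD mulmxDr mulmxDl. Qed.

Lemma sharpN a : sharp (- a) = - sharp a.
Proof. by rewrite /sharp adjointN mulmxN mulNmx. Qed.

Lemma sharpB a X : sharp (a - X) = sharp a - sharp X.
Proof. by rewrite sharpD sharpN. Qed.

Lemma sharpM a X : sharp (a *m X) = sharp X *m sharp a.
Proof.
rewrite /sharp adjointM -!mulmxA; congr (_ *m (_ *m _)).
by rewrite !mulmxA rhoK mul1mx.
Qed.

Lemma sharp1 : sharp (1%:M : 'M[A]_2) = 1%:M.
Proof. by rewrite /sharp adjoint1 mulmx1 rhoK. Qed.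

Lemma sharpZ (r : R) (M : rmx A 2 2) :
  sharp (r *: M : rmx A 2 2) = r *: (sharp M : rmx A 2 2).
Proof. by rewrite /sharp adjointZ rscalemxAr rscalemxAl. Qed.

Lemma theta_mx x y : adjoint x *m rho *m y = (theta x y)%:M.
Proof. by apply/matrixP => i j; rewrite !ord1 [RHS]mxE eqxx mulr1n. Qed.

Lemma theta_mul a x y : theta (a *m x) y = theta x (sharp a *m y).
Proof.
by rewrite /theta /sharp adjointM !mulmxA -(mulmxA _ rho rho) rhoK mulmx1.
Qed.

Lemma theta_star x y : star (theta x y) = theta y x.
Proof. by rewrite !thetaE starB !starM !starK. Qed.

Lemma rscale_mx x (b : A) : rscale x b = x *m b%:M.
Proof.
by apply/matrixP => i j; rewrite !mxE big_ord1 !ord1 mxE eqxx mulr1n.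
Qed.

Lemma theta_rscale x y (b c : A) :
  theta (rscale x b) (rscale y c) = star b * theta x y * c.
Proof. by rewrite !thetaE !mxE !starM mulrBr mulrBl !mulrA. Qed.

Lemma rscaleM x (b c : A) : rscale (rscale x b) c = rscale x (b * c).
Proof. by apply/matrixP => i j; rewrite !mxE mulrA. Qed.

Lemma rscale1 x : rscale x 1 = x.
Proof. by apply/matrixP => i j; rewrite !mxE mulr1 !ord1. Qed.

Lemma mul_rscale a x (b : A) : a *m rscale x b = rscale (a *m x) b.
Proof. by rewrite !rscale_mx mulmxA. Qed.

Lemma mul_proj_of x y : proj_of x *m y = rscale x (theta x y).
Proof. by rewrite rscale_mx -theta_mx /proj_of !mulmxA. Qed.

Lemma rscaleDr x (b c : A) : rscale x (b + c) = rscale x b + rscale x c.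
Proof. by apply/matrixP => i j; rewrite !mxE mulrDr. Qed.

Lemma thetaDr x y z : theta x (y + z) = theta x y + theta x z.
Proof. by rewrite /theta mulmxDr mxE. Qed.
Lemma thetaBl x x' y : theta (x - x') y = theta x y - theta x' y.
Proof. by rewrite /theta adjointB !mulmxBl !mxE. Qed.

Lemma thetaBr x y y' : theta x (y - y') = theta x y - theta x y'.
Proof. by rewrite /theta mulmxBr !mxE. Qed.

(** Let [e_0] be the first basis vector and [a = q 0 0]. As [(1 - q) e_0] is in the
    nullspace, [a - 1] is positive, so [a = g g^*] with [g] invertible, and
    [x = q e_0 h^*] with [h = g^-1] satisfies [theta(x, x) = 1]. The projection
    [q - p_x] kills [e_0], so by symmetry it reduces to an idempotent self-adjoint
    lower corner [d]; its range is in [R(q)], where [theta] is positive, and [theta]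
    takes the value [- d] there. Hence [d = 0]. *)
Lemma Qrho_frame q : Qrho q -> exists x, calK x /\ proj_of x = q.
Proof.
move=> [qq qs posR negN]; pose e0 : 'cV[A]_2 := delta_mx 0 0.
pose w := q *m e0; set a := q 0 0.
have qe (r : 'M[A]_2) (i j : 'I_2) : (r *m (delta_mx j 0 : 'cV[A]_2)) i 0 = r i j.
  by rewrite -colE mxE.
have te0 y : theta e0 y = y 0 0.
  by rewrite thetaE !mxE /= star1 star0 mul0r subr0 mul1r.
have ew : theta e0 w = a by rewrite te0 qe.
have we : theta w e0 = a by rewrite theta_mul qs.
have ww : theta w w = a by rewrite {1}/w theta_mul qs te0 mulmxA qq qe.
have sa : star a = a by rewrite -ww theta_star.
have pa : positive (a - 1).
  have /negN : nullspace q (e0 - w).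
    by rewrite /nullspace /= mulmxBr /w mulmxA qq subrr.
  rewrite thetaBl !thetaBr ww we ew te0 mxE /= subrr subr0.
  by rewrite opprB.
have [g [ag [h [gh hg]]]] := factor_above_one pa.
have sgh : star g * star h = 1 by rewrite -starM hg star1.
have sha : star h * h * a = 1.
  by rewrite ag -mulrA (mulrA h) hg mul1r -starM gh star1.
pose x := rscale w (star h); exists x.
have qx : q *m x = x by rewrite mul_rscale mulmxA qq.
have px : proj_of x *m e0 = w.
  rewrite mul_proj_of rscaleM -[X in theta _ X]rscale1 theta_rscale we starK.
  by rewrite mulr1 mulrA sha rscale1.
split.
  split; first by rewrite theta_rscale ww ag starK !mulrA hg mul1r sgh.
  have -> : x 0 0 = g by rewrite mxE qe -/a ag -mulrA sgh mulr1.
  by exists h.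
have ps : sharp (proj_of x) = proj_of x.
  by rewrite /sharp /proj_of !adjointM adjoint_rho adjointK !mulmxA rhoK mul1mx.
have qp : q *m proj_of x = proj_of x by rewrite /proj_of !mulmxA qx.
have pq : proj_of x *m q = proj_of x by rewrite -ps -{1}qs -sharpM qp.
have pp : proj_of x *m proj_of x = proj_of x.
  have tx : theta x x = 1 by rewrite theta_rscale ww ag starK !mulrA hg mul1r sgh.
  by rewrite {2}/proj_of !mulmxA mul_proj_of tx rscale1.
pose r := q - proj_of x.
have rs : sharp r = r by rewrite sharpB qs ps.
have rr : r *m r = r by rewrite mulmxBl !mulmxBr qq qp pq pp subrr subr0.
have qr : q *m r = r by rewrite mulmxBr qq qp.
have r0 i : r i 0 = 0.
  by rewrite -qe mulmxBl px subrr mxE.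
have r01 : r 0 1 = 0 by rewrite -rs sharpE r0 star0 mulr0 mul0r.
have sd : star (r 1 1) = r 1 1 by rewrite -{2}rs sharpE mulrN1 mulN1r opprK.
have ord2 (i : 'I_2) : i = 0 \/ i = 1.
  by case: i => [[|[|]]] // ?; [left|right]; apply/val_inj.
have dd : r 1 1 * r 1 1 = r 1 1.
  have /matrixP/(_ 1 1) := rr; rewrite mxE (bigD1 1) //= big1 ?addr0 // => k.
  by case: (ord2 k) => ->; rewrite ?eqxx // r0 mul0r.
have d0 : r 1 1 = 0.
  apply: idempotent_positive_opp => //.
  have /posR : mrange q (r *m delta_mx 1 0).
    by exists (r *m delta_mx 1 0); rewrite mulmxA qr.
  by rewrite thetaE !qe r01 star0 mul0r sub0r sd dd.
apply/esym/eqP; rewrite -subr_eq0; apply/eqP/matrixP => i j; rewrite -/r [RHS]mxE.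
by case: (ord2 j) => ->; rewrite ?r0 //; case: (ord2 i) => ->.
Qed.

End IndefiniteForm.

(** * Coefficients of endomorphisms in a frame *)

Section CoefficientAlgebra.
Context {R : realType} {A : cstarAlgType R}.
Implicit Types (q : 'M[A]_2) (x : 'cV[A]_2) (a b : A).

Lemma rvalE q (v : rangeMod q) : q *m q = q -> q *m val v = val v.
Proof. by case: v => _ /= /asboolP[w ->] qq; rewrite mulmxA qq. Qed.

Lemma frame_basis q x (v : rangeMod q) : proj_of x = q -> q *m q = q ->
  val v = rscale x (theta x (val v)).
Proof. by move=> px qq; rewrite -mul_proj_of px rvalE. Qed.

Lemma coef_ext q (f g : coefFiber q) :
  (forall v, val (f v) = val (g v)) -> f = g.
Proof. by move=> fg; apply/val_inj/funext => v; apply/val_inj/fg. Qed.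

Lemma in_mrange_frame q x b : q *m x = x -> rscale x b \in in_mrange q.
Proof. by move=> qx; apply/asboolP; exists (rscale x b); rewrite mul_rscale qx. Qed.

Lemma frame_fixed x : calK x -> proj_of x *m x = x.
Proof. by move=> [xx _]; rewrite mul_proj_of xx rscale1. Qed.

Lemma Qrho_frameP q : Qrho q -> calK (frame q) /\ proj_of (frame q) = q.
Proof. by move=> /Qrho_frame; exact: xgetPex. Qed.

Section Frame.
Context (q : 'M[A]_2) (x : 'cV[A]_2).
Context (qq : q *m q = q) (Kx : calK x) (px : proj_of x = q).

Local Lemma frame_in_range : q *m x = x. Proof. by rewrite -px frame_fixed. Qed.

(** The coordinate of [v] in the frame [x] is [theta(x, v)], so the choice in
    [coef_class] has this unique solution. *)
Lemma coef_classE a (v : rangeMod q) :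
  val (coef_class q x a v) = rscale x (a * theta x (val v)).
Proof.
pose f0 (w : rangeMod q) : rangeMod q :=
  RangeMod (in_mrange_frame (a * theta x (val w)) frame_in_range).
have f0P : f0 \in right_linear (q := q).
  apply/asboolP; split=> [u w|u b]; apply/val_inj => /=.
    by rewrite thetaDr mulrDr rscaleDr.
  by rewrite rscaleM -[X in theta X _]rscale1 theta_rscale star1 mul1r mulrA.
have xx : theta x x = 1 by case: Kx.
have := @xgetPex (coefFiber q) 0 [set f : coefFiber q |
  forall (b : A) (v : rangeMod q), val v = rscale x b ->
    val (f v) = rscale x (a * b)].
rewrite -/(coef_class q x a); apply; last exact: frame_basis.
exists (CoefFiber f0P) => b w /= ->.
by rewrite -[X in theta X _]rscale1 theta_rscale xx star1 mul1r mul1r.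
Qed.

Lemma coef_class_inj : injective (coef_class q x).
Proof.
move=> a b ab; pose v : rangeMod q := RangeMod (in_mrange_frame 1 frame_in_range).
have xx : theta x x = 1 by case: Kx.
have xv : theta x (val v) = 1 by rewrite /= rscale1.
have := coef_classE a v; rewrite ab coef_classE xv !mulr1 => /(congr1 (theta x)).
have tx c : theta x (rscale x c) = c.
  by rewrite -[X in theta X _]rscale1 theta_rscale star1 xx !mul1r.
by rewrite !tx.
Qed.

Lemma coef_classZ (c : R[i]) a :
  c *: coef_class q x a = coef_class q x (c *: a).
Proof.
apply: coef_ext => v; rewrite [LHS]/= coef_classE.
apply/matrixP => i j; rewrite [LHS]mxE coef_classE !mxE mulr_algl.
by rewrite -scalerAl scalerAr.
Qed.

Lemma coef_classB a b :
  coef_class q x a - coef_class q x b = coef_class q x (a - b).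
Proof.
apply: coef_ext => v; rewrite [LHS]/= !coef_classE.
by apply/matrixP => i j; rewrite !mxE mulrBl mulrBr.
Qed.

End Frame.

Lemma coef_star_class q a : Qrho q ->
  coef_star (coef_class q (frame q) a) = coef_class q (frame q) (star a).
Proof.
move=> Qq; have [Kf pf] := Qrho_frameP Qq; have qq : q *m q = q by case: Qq.
rewrite /coef_star; congr (coef_class _ _ (star _)).
by apply: xget_unique => //= b /(coef_class_inj qq Kf pf).
Qed.

Lemma coef_Im_class q a : Qrho q ->
  coef_Im (coef_class q (frame q) a) =
  coef_class q (frame q) ((2 * 'i)^-1 *: (a - star a)).
Proof.
move=> Qq; have [Kf pf] := Qrho_frameP Qq; have qq : q *m q = q by case: Qq.
by rewrite /coef_Im coef_star_class // coef_classB // coef_classZ.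
Qed.

End CoefficientAlgebra.

(** * Symmetry of the second derivative *)

Lemma subrACA (V : zmodType) (x y z t : V) :
  (x - y) - (z - t) = (x - z) - (y - t).
Proof. by rewrite !opprD !opprK addrACA. Qed.

Section SecondDerivative.
Context {R : realType}.
Implicit Types V W : normedModType R.

Lemma differentiable_estimate V W (f : V -> W) (x : V) : differentiable f x ->
  forall e : R, 0 < e -> exists2 d : R, 0 < d &
    forall h, `|h| < d -> `|f (x + h) - f x - 'd f x h| <= e * `|h|.
Proof.
move=> /diff_locally/eqaddoP fx e e0.
have /nbhs_norm0P[d /= d0 Hd] := fx e e0.
exists d => // h /Hd; rewrite [h in `|h|]/= /=.
by rewrite opprD addrA (addrC x) [X in `|X|]/=.
Qed.

Lemma directional_estimate V W (f : V -> W) (x v : V) : differentiable f x ->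
  forall e : R, 0 < e -> exists2 d : R, 0 < d &
    forall h : R, `|h| < d -> `|f (x + h *: v) - f x - h *: 'd f x v| <= e * `|h|.
Proof.
move=> fx e e0; have v1 : 0 < 1 + `|v| by have := normr_ge0 v; lra.
have [d d0 Hd] := differentiable_estimate fx (divr_gt0 e0 v1).
exists (d / (1 + `|v|)) => [|h]; first exact: divr_gt0.
rewrite ltr_pdivlMr // => hd.
have hv : `|h *: v| <= `|h| * (1 + `|v|).
  by rewrite normrZ ler_wpM2l //; lra.
have /Hd := le_lt_trans hv hd; rewrite linearZ => /le_trans; apply.
by rewrite mulrAC ler_pdivrMr // -mulrA ler_wpM2l // ltW.
Qed.

(** For every [e > 0] the bound [(M + e) (b - a)] on the increment of [g] over
    [[a, b]] is additive, and holds near each point by differentiability. *)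
Lemma mean_value_bound W (g g' : R -> W) (M : R) :
  (forall t, 0 <= t <= 1 -> `|g' t| <= M) ->
  (forall t, 0 <= t <= 1 -> forall e : R, 0 < e -> exists2 d : R, 0 < d &
     forall h : R, `|h| < d -> `|g (t + h) - g t - h *: g' t| <= e * `|h|) ->
  `|g 1 - g 0| <= M.
Proof.
move=> g'M gg'; apply/ler_addgt0Pr => e e0.
suff : `|g 1 - g 0| <= (M + e) * (1 - 0) by rewrite subr0 mulr1.
apply: (interval_additive (Q := fun a b => `|g b - g a| <= (M + e) * (b - a))).
  move=> a b c _ ab bc; rewrite -(subrKA (g b)).
  by apply: le_trans (ler_normD _ _) _; lra.
move=> c c01; have [d d0 Hd] := gg' c c01 e e0.
have M0 := g'M c c01.
have side h : `|h| < d -> `|g (c + h) - g c| <= (M + e) * `|h|.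
  move=> /Hd hh; rewrite -(subrK (h *: g' c) (g (c + h) - g c)).
  apply: le_trans (ler_normD _ _) _; rewrite normrZ mulrDl addrC.
  by apply: lerD => //; rewrite mulrC; apply: ler_wpM2r.
exists d => // a b a0 b1 /andP[ca ac] /andP[cb bc].
have := side (b - c); have := side (a - c).
rewrite ler0_norm ?ger0_norm ?(addrC c) ?subrK; [|lra|lra].
move=> /(_ ltac:(lra)) ha /(_ ltac:(lra)) hb.
rewrite -(subrKA (g c)); apply: le_trans (ler_normD _ _) _.
rewrite [X in _ + X]distrC; lra.
Qed.

(** The mixed difference is the increment over [[0, 1]] of
    [s |-> f (q + t X + s t Y) - f (q + s t Y)], whose derivative is
    [t (G (q + t X + s t Y) - G (q + s t Y))] for [G r = df_r(Y)]. Differentiability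
    of [G] at [q] makes this [t^2 dG(X)] up to [o(t^2)], uniformly in [s]. *)
Lemma mixed_difference_estimate V W (f : V -> W) (q X Y : V) :
  (\forall r \near q, differentiable f r) ->
  differentiable (fun r => 'd f r Y) q ->
  forall e : R, 0 < e -> exists2 d : R, 0 < d & forall t : R, 0 < t < d ->
    `|(f (q + t *: X + t *: Y) - f (q + t *: Y)) - (f (q + t *: X) - f q)
      - (t ^+ 2) *: 'd (fun r => 'd f r Y) q X| <= e * t ^+ 2.
Proof.
move=> fq Gq e e0; set G := fun r => 'd f r Y.
set C := 1 + 2 * `|X| + 2 * `|Y|.
have X00 : `|0 : V| <= `|X| by rewrite normr0.
have X0 := normr_ge0 X; have Y0 := normr_ge0 Y.
have C0 : 0 < C by rewrite /C; lra.
have eC : 0 < e / C by exact: divr_gt0.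
have [d1 d1p H1] := differentiable_estimate Gq eC.
have /nbhs_normP[d2 /= d2p H2] := fq.
pose d := Num.min d1 d2; have dp : 0 < d by rewrite lt_min d1p.
exists (d / C) => [|t /andP[t0 td]]; first exact: divr_gt0.
have tCd : t * C < d by rewrite -ltr_pdivlMr.
set L := 'd G q X.
have small (s : R) (u : V) : 0 <= s <= 1 -> `|u| <= `|X| ->
    `|t *: u + (s * t) *: Y| <= t * (`|X| + `|Y|).
  move=> s01 uX; apply: le_trans (ler_normD _ _) _.
  have s0 : 0 <= s by lra.
  rewrite !normrZ (gtr0_norm t0) (ger0_norm s0) mulrDr.
  apply: lerD; first by apply: ler_wpM2l => //; lra.
  rewrite -[leRHS]mul1r -mulrA; apply: ler_wpM2r; [exact: mulr_ge0 (ltW t0) _|lra].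
have inball (s : R) (u : V) : 0 <= s <= 1 -> `|u| <= `|X| ->
    `|t *: u + (s * t) *: Y| < d.
  move=> s01 uX; apply: le_lt_trans (small s u s01 uX) _.
  by apply: le_lt_trans tCd; rewrite /C; nra.
have df (s : R) (u : V) : 0 <= s <= 1 -> `|u| <= `|X| ->
    differentiable f (q + t *: u + (s * t) *: Y).
  move=> s01 uX; apply: H2; rewrite /ball_ /= -addrA opprD addrA subrr add0r normrN.
  by have := inball s u s01 uX; rewrite lt_min => /andP[].
have GE (s : R) (u : V) : 0 <= s <= 1 -> `|u| <= `|X| ->
    `|G (q + t *: u + (s * t) *: Y) - G q - 'd G q (t *: u + (s * t) *: Y)|
    <= e / C * (t * (`|X| + `|Y|)).
  move=> s01 uX; rewrite -(addrA q).
  have := inball s u s01 uX; rewrite lt_min => /andP[/H1 h _].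
  apply: le_trans h _; apply: ler_wpM2l; [exact: ltW|exact: small].
pose h (s : R) := f (q + t *: X + (s * t) *: Y) - f (q + t *: 0 + (s * t) *: Y)
  - s *: (t ^+ 2 *: L).
pose h' (s : R) := t *: (G (q + t *: X + (s * t) *: Y)
  - G (q + t *: 0 + (s * t) *: Y)) - t ^+ 2 *: L.
have := @mean_value_bound W h h' (e * t ^+ 2).
rewrite /h !mul1r !mul0r !scale0r !scale1r !addr0 scaler0 !addr0 subr0.
rewrite addrAC; apply.
- move=> s s01; rewrite /h'.
  have := GE s X s01 (lexx _); have := GE s 0 s01 X00.
  set p1 := q + t *: 0 + _; set p2 := q + t *: X + _.
  set u1 := t *: 0 + _; set u2 := t *: X + _ => g1 g2.
  have -> : t *: (G p2 - G p1) - t ^+ 2 *: L =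
      t *: ((G p2 - G q - 'd G q u2) - (G p1 - G q - 'd G q u1)).
    have uE : u2 - u1 = t *: X by rewrite /u1 scaler0 add0r addrK.
    have -> : t ^+ 2 *: L = t *: ('d G q u2 - 'd G q u1).
      by rewrite -linearB uE linearZ scalerA.
    rewrite -scalerBr; congr (_ *: _).
    by rewrite [RHS]subrACA [X in _ = X - _]subrACA subrr subr0.
  rewrite normrZ gtr0_norm // expr2 mulrCA ler_pM2l //.
  apply: le_trans (ler_normB _ _) _; apply: le_trans (lerD g2 g1) _.
  have eCC : e / C * C = e by rewrite divfK ?gt_eqF.
  rewrite -mulrDr -[X in _ <= X * _]eCC -[leRHS]mulrA ler_pM2l // -mulrDr mulrC.
  rewrite ler_pM2r // /C; lra.
- move=> s s01 e1 e10; have e2 : 0 < e1 / 2 by lra.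
  have [k1 k10 K1] := directional_estimate (t *: Y) (df s X s01 (lexx _)) e2.
  have [k2 k20 K2] := directional_estimate (t *: Y) (df s 0 s01 X00) e2.
  exists (Num.min k1 k2) => [|k]; first by rewrite lt_min k10.
  rewrite lt_min => /andP[/K1 {}K1 /K2 {}K2].
  have shift p : p + ((s + k) * t) *: Y = p + (s * t) *: Y + k *: (t *: Y).
    by rewrite mulrDl scalerDl addrA scalerA.
  have dl p : 'd f p (t *: Y) = t *: 'd f p Y by exact: linearZ.
  rewrite /h /h' !shift; move: K1 K2; rewrite !dl.
  set p1 := q + t *: 0 + _; set p2 := q + t *: X + _ => K1 K2.
  rewrite [X in `|X|](_ : _ =
      (f (p2 + k *: (t *: Y)) - f p2 - k *: (t *: 'd f p2 Y))
    - (f (p1 + k *: (t *: Y)) - f p1 - k *: (t *: 'd f p1 Y))).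
    by apply: le_trans (ler_normB _ _) _; lra.
  rewrite -/(G p1) -/(G p2) [RHS]subrACA -scalerBr -scalerBr.
  rewrite [X in X - _]subrACA (subrACA (f (p2 + _))) -addrA; congr (_ + _).
    by rewrite /p1 scaler0 addr0.
  by rewrite scalerDl addrAC subrr add0r -opprD -scalerDr (addrC (_ *: L)) subrK.
Qed.

(** Up to [o(t^2)] the mixed difference, which is symmetric in [X] and [Y], equals
    [t^2] times either second derivative. *)
Lemma second_differential_sym V W (f : V -> W) (q X Y : V) :
  (\forall r \near q, differentiable f r) ->
  differentiable (fun r => 'd f r X) q ->
  differentiable (fun r => 'd f r Y) q ->
  'd (fun r => 'd f r Y) q X = 'd (fun r => 'd f r X) q Y.
Proof.
move=> fq fX fY; set L := LHS; set L' := RHS.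
apply/eqP; rewrite -subr_eq0 -normr_le0; apply/ler_addgt0Pr => e e0.
rewrite add0r; have e2 : 0 < e / 2 by lra.
have [d d0 H] := mixed_difference_estimate X fq fY e2.
have [d' d0' H'] := mixed_difference_estimate Y fq fX e2.
pose t := Num.min d d' / 2.
have m0 : 0 < Num.min d d' by rewrite lt_min d0.
have t0 : 0 < t by rewrite divr_gt0.
have tm : t < Num.min d d' by rewrite /t; lra.
move: (tm); rewrite lt_min => /andP[td td'].
have := H t; rewrite t0 td => /(_ isT) h.
have := H' t; rewrite t0 td' => /(_ isT) h'.
move: h h'; rewrite (addrAC q) -/L -/L'.
set a := f _; set b := f _; set c := f _; set z := f q.
have -> : a - c - (b - z) = a - b - (c - z) by exact: subrACA.
move=> h h'; have t2 : 0 < t ^+ 2 by rewrite exprn_gt0.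
rewrite -(ler_pM2l t2) -[in t ^+ 2 * `|_|](ger0_norm (ltW t2)) -normrZ scalerBr.
set D := a - b - (c - z) in h h'.
have -> : t ^+ 2 *: L - t ^+ 2 *: L' = (D - t ^+ 2 *: L') - (D - t ^+ 2 *: L).
  by rewrite opprB [RHS]addrC subrKA.
apply: le_trans (ler_normB _ _) _; lra.
Qed.

End SecondDerivative.

(** * Calculus of matrix-valued polynomial maps *)

Section MatrixCalculus.
Context {R : realType} {A : cstarAlgType R}.

(** Matrix multiplication between the real normed spaces [rmx], as a carrier of
    the bilinear structure over the reals. *)
Definition rmul m n p (M : rmx A m n) (N : rmx A n p) : rmx A m p := M *m N.

Lemma rmul_is_bilinear m n p :
  bilinear_for (GRing.Scale.Law.clone _ _ *:%R _)
    (GRing.Scale.Law.clone _ _ *:%R _) (@rmul m n p).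
Proof.
split=> [N|M] a x y; rewrite /rmul /=.
  by rewrite -rscalemxAl -mulmxDl.
by rewrite -rscalemxAr -mulmxDr.
Qed.

HB.instance Definition _ m n p := bilinear_isBilinear.Build R (rmx A m n)
  (rmx A n p) (rmx A m p) _ _ (@rmul m n p) (@rmul_is_bilinear m n p).

Lemma rmul_continuous m n p :
  continuous (fun MN : rmx A m n * rmx A n p => rmul MN.1 MN.2).
Proof.
move=> [M N]; apply/cvgrPdist_lt => e e0.
set c := 1 + `|M| + `|N|.
have M0 := normr_ge0 M; have N0 := normr_ge0 N.
have c0 : 0 < c by rewrite /c; lra.
pose d := Num.min 1 (e / c).
have d0 : 0 < d by rewrite lt_min ltr01 divr_gt0.
exists (ball M d, ball N d); first by split; exact: nbhsx_ballx.
move=> -[M' N'] [] /=; rewrite -!ball_normE /=.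
rewrite !lt_min (distrC M) (distrC N) => /andP[hM1 hM] /andP[hN1 hN].
rewrite distrC; have -> : rmul M' N' - rmul M N =
    rmul (M' - M) (N' - N) + (rmul (M' - M) N + rmul M (N' - N)).
  by rewrite addrA /rmul -mulmxDr subrK mulmxBl mulmxBr addrA subrK.
have h1 := norm_mulmx (M' - M) (N' - N); have h2 := norm_mulmx (M' - M) N.
have h3 := norm_mulmx M (N' - N).
have m0 := normr_ge0 (M' - M); have n0 := normr_ge0 (N' - N).
have ecc : e / c * c = e by rewrite divfK ?gt_eqF.
have ec0 : 0 < e / c by rewrite divr_gt0.
have t1 := ler_normD (rmul (M' - M) (N' - N)) (rmul (M' - M) N + rmul M (N' - N)).
have t2 := ler_normD (rmul (M' - M) N) (rmul M (N' - N)).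
apply: (@lt_le_trans _ _ (e / c * c)); last by rewrite ecc.
by rewrite /rmul in t1 t2 *; rewrite /c; nra.
Qed.

Lemma differentiable_rmul (V : normedModType R) m n p (f : V -> rmx A m n)
    (g : V -> rmx A n p) x : differentiable f x -> differentiable g x ->
  differentiable (fun r => f r *m g r : rmx A m p) x.
Proof.
move=> df dg.
apply: (@differentiable_comp _ _ _ _ (fun r => (f r, g r))
  (fun MN => rmul MN.1 MN.2)); first exact: differentiable_pair.
exact/differentiable_bilin/rmul_continuous.
Qed.

Lemma diff_rmul (V : normedModType R) m n p (f : V -> rmx A m n)
    (g : V -> rmx A n p) x v : differentiable f x -> differentiable g x ->
  'd (fun r => f r *m g r : rmx A m p) x v =
  ('d f x v : rmx A m n) *m g x + f x *m ('d g x v : rmx A n p).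
Proof.
move=> df dg.
have -> : 'd (fun r => f r *m g r : rmx A m p) x =
    'd (fun MN : rmx A m n * rmx A n p => rmul MN.1 MN.2) (f x, g x)
    \o 'd (fun r => (f r, g r)) x :> (V -> _).
  rewrite -diff_comp //; first exact: differentiable_pair.
  exact/differentiable_bilin/rmul_continuous.
rewrite /= diff_pair // diff_bilin; last exact: rmul_continuous.
by rewrite addrC.
Qed.

(** A class of maps stable under the tangent map [(x, v) |-> df_x(v)]: this
    stability is what makes its members smooth, whatever the domain [V]. *)
Inductive poly_map (V : normedModType R) : forall m n, (V -> rmx A m n) -> Prop :=
| poly_lin m n (f : {linear V -> rmx A m n}) : continuous f -> poly_map f
| poly_cst m n (c : rmx A m n) : poly_map (cst c)
| poly_add m n (f g : V -> rmx A m n) :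
    poly_map f -> poly_map g -> poly_map (f + g)
| poly_mul m n p (f : V -> rmx A m n) (g : V -> rmx A n p) :
    poly_map f -> poly_map g -> poly_map (fun r => f r *m g r : rmx A m p).

Lemma poly_comp_linear (V V' : normedModType R) m n (f : V -> rmx A m n)
    (l : {linear V' -> V}) : continuous l -> poly_map f -> poly_map (f \o l).
Proof.
move=> lc; elim=> {m n f} [m n f fc|m n c|m n f g _ hf _ hg|m n p f g _ hf _ hg].
- apply: (@poly_lin _ _ _ (f \o l : {linear _ -> _})) => x.
  by apply: continuous_comp; [exact: lc|exact: fc].
- exact: poly_cst.
- exact: poly_add.
- exact: poly_mul.
Qed.

Lemma poly_differentiable (V : normedModType R) m n (f : V -> rmx A m n) :
  poly_map f -> forall x, differentiable f x.
Proof.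
elim=> {m n f} [m n f fc|m n c|m n f g _ hf _ hg|m n p f g _ hf _ hg] x.
- exact: linear_differentiable.
- exact: differentiable_cst.
- exact: differentiableD.
- exact: differentiable_rmul.
Qed.

Lemma fst_continuous (V : normedModType R) :
  continuous (fst : V * V -> V).
Proof. by move=> x; exact: cvg_fst. Qed.

Lemma snd_continuous (V : normedModType R) :
  continuous (snd : V * V -> V).
Proof. by move=> x; exact: cvg_snd. Qed.

Lemma poly_tangent (V : normedModType R) m n (f : V -> rmx A m n) :
  poly_map f -> poly_map (fun p : V * V => 'd f (p.1) (p.2)).
Proof.
elim=> {m n f} [m n f fc|m n c|m n f g pf hf pg hg|m n p f g pf hf pg hg].
- have -> : (fun p : V * V => 'd f (p.1) (p.2)) = f \o snd.
    by apply/funext => p; rewrite diff_lin.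
  exact: (poly_comp_linear (@snd_continuous V) (poly_lin fc)).
- have -> : (fun p : V * V => 'd (cst c) (p.1) (p.2)) = cst 0.
    by apply/funext => p; rewrite diff_cst.
  exact: poly_cst.
- have -> : (fun p : V * V => 'd (f + g) (p.1) (p.2)) =
      (fun p => 'd f (p.1) (p.2)) + (fun p => 'd g (p.1) (p.2)).
    by apply/funext => p; rewrite diffD //; exact: poly_differentiable.
  exact: (poly_add hf hg).
- have -> : (fun q : V * V => 'd (fun r => f r *m g r : rmx A m p) (q.1) (q.2)) =
      (fun q => ('d f (q.1) (q.2) : rmx A m n) *m g q.1 : rmx A m p) +
      (fun q => f q.1 *m ('d g (q.1) (q.2) : rmx A n p) : rmx A m p).
    by apply/funext => q; rewrite diff_rmul //; exact: poly_differentiable.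
  have pf1 := poly_comp_linear (@fst_continuous V) pf.
  have pg1 := poly_comp_linear (@fst_continuous V) pg.
  exact: (poly_add (poly_mul hf pg1) (poly_mul pf1 hg)).
Qed.

(** The induction on the order replaces the domain [V] by [V * V] at each step. *)
Lemma poly_smooth (V : normedModType R) m n (U : set V) (f : V -> rmx A m n) :
  poly_map f -> smooth_on U f.
Proof.
move=> pf k; elim: k V U f pf => [|k IH] V U f pf /=.
  by move=> x _; exact/differentiable_continuous/poly_differentiable.
split; first by move=> x _; exact: poly_differentiable.
exact/IH/poly_tangent.
Qed.

End MatrixCalculus.

(** * Curves in the manifold and derivatives of sections *)

(** [f] vanishes at points [q + t Y + O(t^2)], and
    [f (q + t Y + O(t^2)) = t df(Y) + o(t)]. *)
Lemma diff_zero_along_curve (R : realType) (V W : normedModType R) (f : V -> W)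
    (q Y : V) (C d : R) :
  differentiable f q -> f q = 0 -> 0 < d -> 0 <= C ->
  (forall t : R, 0 < t < d ->
     exists p, f p = 0 /\ `|p - q - t *: Y| <= C * t ^+ 2) ->
  'd f q Y = 0.
Proof.
move=> df fq0 d0 C0 Hp.
have [K K0 HK] : exists2 K : R, 0 < K & forall h, `|'d f q h| <= K * `|h|.
  have /linear_bounded_continuous/bounded_funP := diff_continuous df.
  move=> /(_ 1)[K HK]; exists (`|K| + 1); first by have := normr_ge0 K; lra.
  move=> h; have [->|h0] := eqVneq h 0; first by rewrite linear0 !normr0 mulr0.
  have hp : 0 < `|h| by rewrite normr_gt0.
  have := HK (`|h|^-1 *: h); rewrite linearZ /= !normrZ normfV normr_id.
  rewrite mulVf ?gt_eqF // => /(_ (lexx _)).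
  rewrite ler_pdivrMl // mulrC => /le_trans; apply.
  by rewrite ler_pM2r //; have := ler_norm K; lra.
apply/eqP; rewrite -normr_le0; apply/ler_addgt0Pr => e e0; rewrite add0r.
have Y0 := normr_ge0 Y; set y := 1 + `|Y|.
have y0 : 0 < y by rewrite /y; lra.
have e'0 : 0 < e / (2 * y) by rewrite divr_gt0 // mulr_gt0.
have [d1 d10 H1] := differentiable_estimate df e'0.
have c0 : 0 < C + 1 by lra.
have kc0 : 0 < K * C + 1 by have := mulr_ge0 (ltW K0) C0; lra.
(* [t] is small enough that the errors [K C t^2] and [o(t)] are at most [e t / 2] *)
pose m := Num.min (Num.min d (C + 1)^-1) (Num.min (d1 / y) (e / 2 / (K * C + 1))).
have m0 : 0 < m by rewrite !lt_min d0 invr_gt0 c0 !divr_gt0.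
pose t := m / 2; have t0 : 0 < t by rewrite divr_gt0.
have : t < m by rewrite /t; lra.
rewrite !lt_min => /andP[/andP[td tC] /andP[td1 te]].
have [p [fp pq]] := Hp t ltac:(by rewrite t0).
have tC1 : C * t <= 1.
  have : t * (C + 1) < 1 by rewrite -ltr_pdivlMr // div1r.
  lra.
have pqn : `|p - q| <= t * y.
  rewrite -[p - q](subrK (t *: Y)); apply: le_trans (ler_normD _ _) _.
  rewrite normrZ gtr0_norm // /y mulrDr mulr1; apply: lerD => //.
  by apply: le_trans pq _; rewrite expr2 mulrA; nra.
have : `|p - q| < d1 by apply: le_lt_trans pqn _; rewrite -ltr_pdivlMr.
move=> /H1; rewrite (addrC q) subrK fp fq0 subr0 sub0r normrN => h1.
have h2 := HK (p - q - t *: Y).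
have h3 : t * `|'d f q Y| <= `|'d f q (p - q)| + `|'d f q (p - q - t *: Y)|.
  rewrite -[in t * _](gtr0_norm t0) -normrZ.
  have -> : t *: 'd f q Y = 'd f q (p - q) - 'd f q (p - q - t *: Y).
    by rewrite -linearB opprB addrC subrK linearZ.
  exact: ler_normB.
have h4 : `|'d f q (p - q)| <= e / 2 * t.
  apply: le_trans h1 _; apply: (@le_trans _ _ (e / (2 * y) * (t * y))).
    by rewrite ler_pM2l.
  by have -> : e / (2 * y) * (t * y) = e / 2 * t by field; rewrite gt_eqF.
have h5 : `|'d f q (p - q - t *: Y)| <= e / 2 * t.
  apply: le_trans h2 _; apply: (@le_trans _ _ (K * (C * t ^+ 2))).
    by rewrite ler_pM2l.
  have : t * (K * C + 1) < e / 2 by rewrite -ltr_pdivlMr.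
  rewrite expr2 => ?; have := mulr_ge0 (ltW K0) C0; nra.
by rewrite -(ler_pM2l t0); lra.
Qed.

Lemma diff_sub (R : realType) (V W : normedModType R) (f g : V -> W) x v :
  differentiable f x -> differentiable g x ->
  'd (f - g) x v = 'd f x v - 'd g x v.
Proof. by move=> df dg; rewrite diffB. Qed.

Section Cayley.
Context {R : realType} {A : cstarAlgType R}.
Local Notation M2 := (rmx A 2 2).
Local Notation rho := (@rho R A).

Lemma tangent_offdiag (q X : 'M[A]_2) : q *m q = q -> tangent q X ->
  q *m X *m q = 0.
Proof.
move=> qq [_ Xq]; have := congr1 (fun M => q *m M) Xq.
by rewrite mulmxDr !mulmxA qq -[RHS]add0r => /addIr.
Qed.

(** A [theta]-unitary [G] carries range and nullspace of [q] to those of the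
    conjugate, and preserves the values of [theta] on them. *)
Lemma Qrho_conj (q G : 'M[A]_2) : sharp G *m G = 1%:M -> G *m sharp G = 1%:M ->
  Qrho q -> Qrho (G *m q *m sharp G).
Proof.
move=> G1 G2 [qq qs posR negN]; split.
- move: (sharp G) G1 => H HG.
  by rewrite !mulmxA -(mulmxA _ H G) HG mulmx1 -(mulmxA G q q) qq.
- rewrite (sharpM _ (sharp G)) (sharpM G) sharpK qs.
  by move: (sharp G) => H; rewrite mulmxA.
- move=> _ [w ->].
  have /posR : mrange q (q *m (sharp G *m w)) by exists (sharp G *m w).
  have -> : G *m q *m sharp G *m w = G *m (q *m (sharp G *m w)).
    by move: (sharp G) => H; rewrite !mulmxA.
  by rewrite (theta_mul G) (mulmxA (sharp G) G) G1 mul1mx.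
- move=> x Nx.
  have : nullspace q (sharp G *m x).
    move: (sharp G) G1 Nx => H HG Nx; rewrite /nullspace /= in Nx *.
    rewrite -[LHS]mul1mx -HG -(mulmxA H G) (mulmxA G q) (mulmxA (G *m q)) Nx.
    by rewrite mulmx0.
  move=> /negN; rewrite (theta_mul (sharp G)) sharpK (mulmxA G (sharp G)) G2.
  by rewrite mul1mx.
Qed.

Lemma norm_sharp (M : M2) :
  `|(sharp M : M2)| <= `|(rho : M2)| ^+ 2 * `|M|.
Proof.
apply: le_trans (norm_mulmx _ _) _; rewrite expr2 mulrAC; apply: ler_wpM2r => //.
by apply: le_trans (norm_mulmx _ _) _; rewrite norm_adjoint.
Qed.

(** The commutator [Z_0 = [Y, q]] satisfies [Z_0^sharp = - Z_0] and [[Z_0, q] = Y].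
    For [Z = t Z_0 / 2] the Cayley transform [G = (1 + Z) (1 - Z)^-1] is therefore
    [theta]-unitary, and since [G = 1 + 2 Z + O(t^2)], the conjugate of [q] by [G]
    is [q + 2 [Z, q] + O(t^2) = q + t Y + O(t^2)]. *)
Lemma cayley_curve (q Y : M2) : Qrho q -> tangent q Y ->
  exists C d : R, [/\ 0 <= C, 0 < d & forall t : R, 0 < t < d ->
    exists p : M2, Qrho p /\ `|p - q - t *: Y| <= C * t ^+ 2].
Proof.
move=> Qq tY; have [qq qs _ _] := Qq.
have qYq : q *m Y *m q = 0 by exact: tangent_offdiag.
have [Ys Yq] := tY; have {}Ys : sharp Y = Y by [].
pose Z0 : M2 := Y *m q - q *m Y.
have Z0s : sharp Z0 = - Z0 by rewrite sharpB !sharpM qs Ys opprB.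
have Z0q : Z0 *m q - q *m Z0 = Y.
  rewrite mulmxBl mulmxBr !mulmxA qYq -(mulmxA Y) qq subr0 sub0r opprK.
  exact: Yq.
set N := `|Z0|; have N0 : 0 <= N by exact: normr_ge0.
set I := 1%:M : M2; set b := 2 * `|I|; set r2 := `|(rho : M2)| ^+ 2.
have b0 : 0 <= b by rewrite mulr_ge0.
have r20 : 0 <= r2 by rewrite exprn_ge0.
have nq0 := normr_ge0 q.
pose C1 := 2 * b * (`|q| + `|q| * r2) + 2 * b * `|q| * (r2 * (2 * b)).
exists (C1 * N ^+ 2), (N + 1)^-1; split.
- rewrite mulr_ge0 ?exprn_ge0 // /C1.
  by do ?[apply: addr_ge0|apply: mulr_ge0] => //; lra.
- by rewrite invr_gt0; lra.
move=> t /andP[t0 td].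
pose Z : M2 := (t / 2) *: Z0.
have Zs : sharp Z = - Z by rewrite sharpZ Z0s scalerN.
have Zn : `|Z| = t / 2 * N by rewrite normrZ gtr0_norm //; lra.
have tN : t * (N + 1) < 1 by rewrite -ltr_pdivlMr ?div1r //; lra.
have Zq : (Z *m q : M2) - q *m Z + ((Z *m q : M2) - q *m Z) = t *: Y.
  rewrite rscalemxAl rscalemxAr -scalerBr Z0q -scalerDl; congr (_ *: _); lra.
have Zsmall : `|Z| <= 1 / 2 by rewrite Zn; lra.
have [B [SB BS Bn]] := neumann Zsmall; rewrite -/I -/b in Bn.
set S : 'M[A]_2 := 1%:M - Z in SB BS; set S' : 'M[A]_2 := 1%:M + Z.
have Ss : sharp S = S' by rewrite sharpB sharp1 Zs opprK.
have S's : sharp S' = S by rewrite -Ss sharpK.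
have [B' B'E] : exists B' : 'M[A]_2, B' = sharp B by exists (sharp B).
have S'B' : S' *m B' = 1%:M by rewrite B'E -Ss -sharpM BS sharp1.
have B'S' : B' *m S' = 1%:M by rewrite B'E -Ss -sharpM SB sharp1.
have SS' : S *m S' = S' *m S.
  rewrite /S /S' mulmxBl mul1mx (mulmxDr Z) mulmx1 addrKA.
  by rewrite mulmxDl mul1mx (mulmxBr Z) mulmx1 subrKA.
have BB' : B *m B' = B' *m B.
  transitivity (B *m B' *m (S *m S' *m (B' *m B))).
    by rewrite (mulmxA _ B') -(mulmxA S) S'B' mulmx1 SB mulmx1.
  by rewrite SS' mulmxA (mulmxA _ S') -(mulmxA B B') B'S' mulmx1 BS mul1mx.
set G : 'M[A]_2 := S' *m B.
have Gs : sharp G = B' *m S by rewrite sharpM S's B'E.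
have G1 : sharp G *m G = 1%:M.
  by rewrite Gs /G !mulmxA -(mulmxA B') SS' mulmxA B'S' mul1mx SB.
have G2 : G *m sharp G = 1%:M.
  by rewrite Gs /G !mulmxA -(mulmxA S') BB' mulmxA S'B' mul1mx BS.
exists (G *m q *m sharp G); split; first exact: Qrho_conj.
(* [U = G - 1] is of first order in [Z], and [V = U - 2 Z] of second order *)
have BE : B = I + Z *m B.
  by rewrite -[I]SB mulmxBl mul1mx subrK.
pose U : M2 := Z *m B + Z *m B.
pose V : M2 := Z *m (Z *m B) + Z *m (Z *m B).
have GU : G = I + U.
  by rewrite /G mulmxDl mul1mx {1}BE /U addrA.
have UV : U = Z + Z + V.
  by rewrite /U {1 2}BE !mulmxDr mulmx1 addrACA.
have ZB : `|(Z *m B : M2)| <= `|Z| * b.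
  by apply: le_trans (norm_mulmx _ _) _; exact: ler_wpM2l.
have Un : `|U| <= 2 * `|Z| * b.
  by apply: le_trans (ler_normD _ _) _; lra.
have Vn : `|V| <= 2 * `|Z| ^+ 2 * b.
  have h : `|(Z *m (Z *m B) : M2)| <= `|Z| * (`|Z| * b).
    by apply: le_trans (norm_mulmx _ _) _; exact: ler_wpM2l.
  by apply: le_trans (ler_normD _ _) _; lra.
have Gs' : sharp G = I + sharp U by rewrite GU sharpD sharp1.
have Us : sharp U = sharp V - (Z + Z) by rewrite UV !sharpD Zs addrC opprD.
have -> : G *m q *m sharp G - q - t *: Y =
   (V *m q : M2) + ((q *m sharp V : M2) + (U *m q *m sharp U : M2)).
  have first : U *m q + q *m sharp U = t *: Y + (V *m q + q *m sharp V).
    rewrite Us -Zq UV mulmxDl mulmxBr !(mulmxDl, mulmxDr) [X in _ = X + _]addrACA.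
    by rewrite -opprD [RHS]addrACA; congr (_ + _); rewrite addrC.
  rewrite Gs' GU mulmxDl mul1mx mulmxDr mulmx1 mulmxDl -!addrA (addrCA q).
  move: first; move: (U *m q) (q *m sharp U) (U *m q *m sharp U) => a c w first.
  by rewrite (addrC w) !addrA (addrAC a) addrK first (addrC (t *: Y)) addrK.
have n1 := norm_mulmx V q; have n2 := norm_mulmx q (sharp V : M2).
have n3 := norm_mulmx (U *m q : M2) (sharp U : M2); have n4 := norm_mulmx U q.
have n5 := norm_sharp V; have n6 := norm_sharp U; rewrite -/r2 in n5 n6.
have t1 := ler_normD (V *m q : M2) ((q *m sharp V : M2) + (U *m q *m sharp U : M2)).
have t2 := ler_normD (q *m sharp V : M2) (U *m q *m sharp U : M2).
have ZN : `|Z| ^+ 2 <= N ^+ 2 * t ^+ 2.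
  rewrite -exprMn lerXn2r ?nnegrE ?mulr_ge0 ?normr_ge0 // ?(ltW t0) // Zn.
  by have := mulr_ge0 N0 (ltW t0); lra.
have u0 := normr_ge0 U; have v0 := normr_ge0 V.
have z0 := normr_ge0 Z; have zb0 := mulr_ge0 z0 b0.
have m1 : `|(V *m q : M2)| <= 2 * `|Z| ^+ 2 * b * `|q|.
  by apply: le_trans n1 _; exact: ler_wpM2r.
have m2 : `|(q *m sharp V : M2)| <= `|q| * (r2 * (2 * `|Z| ^+ 2 * b)).
  apply: le_trans n2 _; apply: ler_wpM2l => //; apply: le_trans n5 _.
  exact: ler_wpM2l.
have m3 : `|(U *m q *m sharp U : M2)| <=
    (2 * `|Z| * b * `|q|) * (r2 * (2 * `|Z| * b)).
  apply: le_trans n3 _; apply: ler_pM => //.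
    by apply: le_trans n4 _; exact: ler_wpM2r.
  by apply: le_trans n6 _; exact: ler_wpM2l.
have C10 : 0 <= C1.
  by rewrite /C1; do ?[apply: addr_ge0|apply: mulr_ge0] => //; lra.
apply: (@le_trans _ _ (C1 * `|Z| ^+ 2)); last first.
  by rewrite -mulrA; exact: ler_wpM2l.
apply: le_trans t1 _; apply: le_trans (lerD m1 (le_trans t2 (lerD m2 m3))) _.
by rewrite /C1 le_eqVlt; apply/orP; left; apply/eqP; ring.
Qed.

(** The map [r |-> s r - r s r] vanishes on [Qrho], hence its derivative at [q]
    vanishes in tangent directions. *)
Lemma section_diff (s : M2 -> rmx A 2 1) (U : set M2) (q Y : M2) :
  open U -> U q -> (forall r, U r -> Qrho r -> mrange r (s r)) ->
  differentiable s q -> Qrho q -> tangent q Y ->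
  'd s q Y - q *m ('d s q Y : rmx A 2 1) = Y *m s q.
Proof.
move=> oU Uq sU ds Qq tY.
have fixs r : U r -> Qrho r -> r *m s r = s r.
  move=> Ur Qr; case: (sU r Ur Qr) => w ->; case: Qr => rr _ _ _.
  by rewrite mulmxA rr.
pose g (r : M2) : rmx A 2 1 := r *m s r.
pose f := s - g; have fE r : f r = s r - g r by [].
have did : differentiable (id : M2 -> M2) q by [].
have dm : differentiable g q := differentiable_rmul did ds.
have df : differentiable f q := differentiableB ds dm.
have [C [d [C0 d0 Hp]]] := cayley_curve Qq tY.
have /nbhs_ballP[e /= e0 He] : nbhs q U by exact: open_nbhs_nbhs.
have Y0 := normr_ge0 Y.
have c0 : 0 < C + `|Y| + 1 by lra.
have df0 : 'd f q Y = 0.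
  apply: (@diff_zero_along_curve _ _ _ f q Y C
    (Num.min (Num.min 1 d) (e / (C + `|Y| + 1)))) => //.
  - by rewrite fE /g fixs // subrr.
  - by rewrite !lt_min ltr01 d0 divr_gt0.
  move=> t; rewrite !lt_min => /andP[t0 /andP[/andP[t1 td] te]].
  have [|p [Qp pq]] := Hp t; first by rewrite t0.
  exists p; split=> //; rewrite fE /g fixs ?subrr //; apply: He.
  rewrite -ball_normE /= distrC -[p - q](subrK (t *: Y)).
  apply: le_lt_trans (ler_normD _ _) _; rewrite normrZ gtr0_norm //.
  have : t * (C + `|Y| + 1) < e by rewrite -ltr_pdivlMr.
  have : C * t ^+ 2 <= C * t by apply: ler_wpM2l => //; rewrite expr2; nra.
  by lra.
have /esym/eqP := etrans (esym df0) (diff_sub Y ds dm).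
have idY : 'd (id : M2 -> M2) q Y = Y.
  exact: (congr1 (fun h => h Y) (@diff_val _ _ _ _ _ _ _ (is_diff_id q))).
have := diff_rmul Y did ds; rewrite idY => dgE.
rewrite subr_eq0 => /eqP ds_dg.
by apply/eqP; rewrite subr_eq; apply/eqP; exact: (etrans ds_dg dgE).
Qed.
End Cayley.

(** * The curvature *)

Section DerivativeAlongField.
Context {R : realType} {V W : normedModType R}.
Context (s : V -> W) (q : V).
Local Definition tangent_map (p : V * V) : W := 'd s (p.1) (p.2).
Local Notation T := tangent_map.

Lemma diff_freeze (Y v : V) : differentiable T (q, Y) ->
  differentiable (fun r => 'd s r Y) q /\
  'd (fun r => 'd s r Y) q v = 'd T (q, Y) (v, 0).
Proof.
move=> dT; have di : differentiable (fun r : V => (r, cst Y r)) q.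
  by apply: differentiable_pair.
split; first exact: (differentiable_comp di dT).
have := diff_comp di dT => /(congr1 (fun h => h v)) -> /=.
by rewrite diff_pair // diff_cst diff_val.
Qed.

Lemma diff_fiber (Y w : V) : differentiable s q -> differentiable T (q, Y) ->
  'd T (q, Y) (0, w) = 'd s q w.
Proof.
move=> ds dT; have di : differentiable (fun r : V => (cst q r, r)) Y.
  by apply: differentiable_pair.
have := diff_comp di dT => /(congr1 (fun h => h w)) /=.
rewrite diff_pair // diff_cst diff_val => <-.
by rewrite (_ : T \o _ = 'd s q) // diff_lin //; exact: diff_continuous.
Qed.

(** The differential of [T] at [(q, F q)], applied to [(v, dF(v))], is the sum of
    its values at [(v, 0)] and [(0, dF(v))]; [T] is linear in its
    second argument. *)
Lemma diff_along_field (F : V -> V) (v : V) :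
  differentiable s q -> differentiable T (q, F q) -> differentiable F q ->
  differentiable (fun r => 'd s r (F r)) q /\
  'd (fun r => 'd s r (F r)) q v =
    'd (fun r => 'd s r (F q)) q v + 'd s q ('d F q v).
Proof.
move=> ds dT dF; have di : differentiable (fun r : V => (r, F r)) q.
  by apply: differentiable_pair.
split; first exact: (differentiable_comp di dT).
have [_ ->] := diff_freeze v dT; rewrite -(diff_fiber _ ds dT) -linearD.
have := diff_comp di dT => /(congr1 (fun h => h v)) -> /=.
by rewrite diff_pair // diff_val; congr ('d _ _ (_, _)); rewrite ?addr0 ?add0r.
Qed.

End DerivativeAlongField.

Section Curvature.
Context {R : realType} {A : cstarAlgType R}.
Local Notation M2 := (rmx A 2 2).
Local Notation A2 := (rmx A 2 1).

Lemma diff_connection (U : set M2) (Xf : M2 -> M2) (s : M2 -> A2) (q v : M2) :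
  U q -> smooth_on U Xf -> smooth_on U s ->
  'd (connection Xf s) q v = v *m ('d s q (Xf q) : A2) +
    q *m ('d (fun r => 'd s r (Xf q)) q v + 'd s q ('d Xf q v) : A2).
Proof.
move=> Uq sX ss.
have [/(_ q Uq) dX _] := sX 1%N.
have [/(_ q Uq) ds [dT _]] := ss 2%N.
have {}dT : differentiable (fun p : M2 * M2 => 'd s (p.1) (p.2)) (q, Xf q).
  by apply: dT; split.
have [dc E] := diff_along_field v ds dT dX.
have did : differentiable (id : M2 -> M2) q by [].
have idv : 'd (id : M2 -> M2) q v = v.
  exact: (congr1 (fun h => h v) (@diff_val _ _ _ _ _ _ _ (is_diff_id q))).
have e1 := congr1 (fun z : M2 => z *m ('d s q (Xf q) : A2)) idv.
have e2 := congr1 (mulmx q) E.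
exact: (etrans (diff_rmul v did dc) (congr2 +%R e1 e2)).
Qed.

(** [u] and [v] stand for the first derivatives of the section, [h] for its mixed
    second derivative, and [a], [b] for its derivatives along [dY(X)], [dX(Y)]. *)
Lemma curvature_algebra (q X Y : 'M[A]_2) (u v h a b : 'cV[A]_2) : q *m q = q ->
  q *m (X *m u + q *m (h + a)) - q *m (Y *m v + q *m (h + b)) - q *m (a - b)
  = q *m X *m u - q *m Y *m v.
Proof.
move=> qq; rewrite mulmxBr !mulmxDr !mulmxA qq.
move: (q *m X *m u) (q *m Y *m v) (q *m h) (q *m a) (q *m b) => x y z c d.
rewrite (addrCA x) (addrCA y) (opprD z) addrACA subrr add0r.
by rewrite (opprD y) addrACA addrK.
Qed.

(** This is where symmetry of second derivatives and the relation
    [(1 - q) ds(Z) = Z s(q)] enter. *)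
Lemma curvature_value (U : set M2) (Xf Yf : M2 -> M2) (s : M2 -> A2) (q : M2) :
  open U -> U q -> Qrho q ->
  local_field U Xf -> local_field U Yf -> local_section U s ->
  connection Xf (connection Yf s) q - connection Yf (connection Xf s) q
    - connection (lie_bracket Xf Yf) s q =
  q *m Xf q *m Yf q *m s q - q *m Yf q *m Xf q *m s q :> A2.
Proof.
move=> oU Uq Qq [sX tX] [sY tY] [ss rs].
have [ds [dT _]] := ss 2%N.
set X := Xf q; set Y := Yf q.
have dTq (Z : M2) : differentiable (fun p : M2 * M2 => 'd s (p.1) (p.2)) (q, Z).
  by apply: dT; split.
have sym : 'd (fun r => 'd s r Y) q X = 'd (fun r => 'd s r X) q Y.
  apply: second_differential_sym.
  - apply: filterS (open_nbhs_nbhs (conj oU Uq)) => r; exact: ds.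
  - by have [] := diff_freeze 0 (dTq X).
  - by have [] := diff_freeze 0 (dTq Y).
have qq : q *m q = q by case: Qq.
have proj (Z : M2) : tangent q Z -> Z *m s q = 'd s q Z - q *m ('d s q Z : A2).
  by move=> tZ; rewrite (section_diff oU Uq rs (ds q Uq) Qq tZ).
have part (Z Z' : M2) : tangent q Z -> tangent q Z' ->
    q *m Z *m Z' *m s q = q *m Z *m ('d s q Z' : A2).
  move=> tZ tZ'; rewrite -mulmxA proj // mulmxBr (mulmxA (q *m Z)).
  by rewrite tangent_offdiag // mul0mx subr0.
have hX : tangent q X by exact: tX.
have hY : tangent q Y by exact: tY.
rewrite (part X Y hX hY) (part Y X hY hX).
have c1 : connection Xf (connection Yf s) q = _ :=
  congr1 (mulmx q) (diff_connection X Uq sY ss).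
have c2 : connection Yf (connection Xf s) q = _ :=
  congr1 (mulmx q) (diff_connection Y Uq sX ss).
have c3 : connection (lie_bracket Xf Yf) s q = _ :=
  congr1 (mulmx q) (linearB ('d s q) ('d Yf q X) ('d Xf q Y)).
have c1' := etrans c1 (congr1 (fun h : A2 => q *m (X *m ('d s q Y : A2) +
  q *m (h + 'd s q ('d Yf q X)))) sym).
apply: (etrans (congr2 (fun u w : A2 => u - w)
  (congr2 (fun u w : A2 => u - w) c1' c2) c3)).
exact: curvature_algebra.
Qed.

(** A polynomial field extending a tangent vector [Z]: the off-diagonal part of [Z]
    for the decomposition by [r]. *)
Definition offdiag (Z r : 'M[A]_2) : 'M[A]_2 :=
  r *m Z *m (1%:M - r) + (1%:M - r) *m Z *m r.

Lemma offdiag_tangent (r Z : 'M[A]_2) : r *m r = r -> sharp r = r ->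
  sharp Z = Z -> tangent r (offdiag Z r).
Proof.
move=> rr rs Zs; have c0 : (1%:M - r) *m r = 0 by rewrite mulmxBl mul1mx rr subrr.
have c1 : r *m (1%:M - r) = 0 by rewrite mulmxBr mulmx1 rr subrr.
split.
  rewrite -/(sharp _) sharpD !(sharpM _ r) !(sharpM _ (1%:M - r)) !sharpM.
  by rewrite sharpB sharp1 rs Zs !mulmxA addrC.
rewrite /offdiag mulmxDl (mulmxDr r) !mulmxA -(mulmxA (r *m Z)) c0 mulmx0 add0r.
by rewrite rr c1 !mul0mx addr0 -(mulmxA _ r r) rr addrC.
Qed.

Lemma offdiag_id (q X : 'M[A]_2) : q *m q = q -> tangent q X -> offdiag X q = X.
Proof.
move=> qq tX; have qXq := tangent_offdiag qq tX; case: tX => _ Xq.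
rewrite /offdiag mulmxBr mulmx1 qXq subr0 mulmxBl mul1mx mulmxBl qXq subr0.
by rewrite addrC.
Qed.

(** The endomorphism [X Y - Y X] satisfies the defining property of the curvature by
    [curvature_value]. It is the only one: test on the fields [offdiag X],
    [offdiag Y] and the section [r |-> r v]. *)
Lemma curvature_fiber (q X Y : M2) : Qrho q -> tangent q X -> tangent q Y ->
  curvature q X Y = coef_class q (frame q)
    (theta (X *m frame q) (Y *m frame q) - theta (Y *m frame q) (X *m frame q)).
Proof.
move=> Qq tX tY; have [qq qs _ _] := Qq.
have [Kf pf] := Qrho_frameP Qq.
set x := frame q in Kf pf *.
have sh Z : tangent q Z -> sharp Z = Z by case.
set F := coef_class q x _.
have FE (v : rangeMod q) :
    val (F v) = q *m X *m Y *m val v - q *m Y *m X *m val v.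
  have qZv Z Z' : tangent q Z -> q *m Z *m Z' *m val v =
      rscale x (theta (Z *m x) (Z' *m x) * theta x (val v)).
    move=> tZ; rewrite [val v in LHS](frame_basis v pf qq) mul_rscale.
    by rewrite theta_mul sh // -!mulmxA -{1}pf mul_proj_of rscaleM !mulmxA.
  rewrite !qZv // coef_classE //.
  by apply/matrixP => i j; rewrite !mxE mulrBl mulrBr.
have FC : is_curvature X Y F.
  move=> U Xf Yf s oU Uq lX lY ls XE YE v sv.
  by rewrite (curvature_value oU Uq Qq lX lY ls) XE YE sv FE.
apply: xget_unique => // F' F'C; apply: coef_ext => v.
pose sec (r : M2) : A2 := r *m val v.
have pid : poly_map (id : M2 -> M2).
  by apply: (@poly_lin _ _ _ _ _ (idfun : {linear M2 -> M2})) => ?; exact: id.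
have pc m n (c : rmx A m n) := poly_cst M2 c.
have pN : poly_map (fun r : M2 => 1%:M - r).
  have -> : (fun r : M2 => 1%:M - r : M2) =
      cst 1%:M + (fun r => (- 1%:M : M2) *m r : M2).
    by apply/funext => r; apply: (congr1 (+%R (1%:M : M2))); rewrite mulNmx mul1mx.
  exact: (poly_add (pc _ _ _) (poly_mul (pc _ _ _) pid)).
have pfld Z : poly_map (offdiag Z : M2 -> M2).
  exact: (poly_add (poly_mul (poly_mul pid (pc _ _ Z)) pN)
    (poly_mul (poly_mul pN (pc _ _ Z)) pid)).
have psec : poly_map sec by exact: (poly_mul pid (pc _ _ (val v))).
have lfld Z : tangent q Z -> local_field setT (offdiag Z) /\ offdiag Z q = Z.
  move=> tZ; split; last exact: offdiag_id.
  split; first exact: poly_smooth.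
  by move=> r _ [rr rs _ _]; apply: offdiag_tangent => //; exact: sh.
have lsec : local_section setT sec.
  split; first exact: poly_smooth.
  by move=> r _ _; exists (val v).
have [lX XE] := lfld X tX; have [lY YE] := lfld Y tY.
have sv : sec q = val v by rewrite /sec rvalE.
have h := F'C setT _ _ _ openT I lX lY lsec XE YE v sv.
have h' := FC setT _ _ _ openT I lX lY lsec XE YE v sv.
by rewrite h h'.
Qed.

End Curvature.

Theorem theorem6p1 (R : realType) (A : cstarAlgType R) (q X Y : 'M[A]_2)
    (hq : Qrho q) (hX : tangent q X) (hY : tangent q Y) :
  ('i / 2) *: curvature q X Y = coef_Im (hilbert_product q X Y) /\
  coef_Im (hilbert_product q X Y) = omega q X Y.
Proof.
split=> //; have [Kf pf] := Qrho_frameP hq; have [qq _ _ _] := hq.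
rewrite /hilbert_product coef_Im_class // curvature_fiber // coef_classZ //.
congr (coef_class _ _ _); rewrite starN theta_star opprK [- _ + _]addrC.
rewrite -[theta (Y *m _) _ - _]opprB scalerN -scaleNr; congr (_ *: _).
have i0 : ('i : R[i]) != 0 by exact: neq0Ci.
have ii : ('i : R[i]) ^+ 2 = -1 by exact: sqr_i.
apply: (mulfI i0); rewrite mulrA -expr2 ii invfM mulrN (mulrCA _ 2^-1).
by rewrite mulfV // mulr1 mulN1r.
Qed.
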